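(* Let $\mathbf K$ be a field of characteristic zero with algebraic closure $\overline{\mathbf K}$, let $p\le q$, and let $\boldsymbol g=(g_1,\dots,g_s)\in\mathbf K[x_1,\dots,x_n]^s$ and $\boldsymbol F=[f_{i,j}]\in\mathbf K[x_1,\dots,x_n]^{p\times q}$, with $n=q-p+s+1$. Let $N$, $\mathfrak B$ and $\Theta_\rho$ be as in the context. There exists a non-empty Zariski open subset $\Omega$ of $\overline{\mathbf K}^N$ such that for every $\rho\in\Omega$, writing $\boldsymbol B=\Theta_\rho(\mathfrak B)$: (i) the ideal generated by $\boldsymbol B_{t=0}$ in $\overline{\mathbf K}[x_1,\dots,x_n]$ is radical and of dimension zero; (ii) all points of $V(\boldsymbol B)\subset\overline{\mathbf K}\langle\langle t\rangle\rangle^n$ are bounded.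
   Context: Supports: $\mathcal A_i\subset\mathbb N^n$ ($1\le i\le s$) is the support (set of exponents of non-zero terms) of $g_i$ together with the origin $\mathbf 0$; $\mathcal B_j\subset\mathbb N^n$ ($1\le j\le q$) is the union of the supports of the entries of the $j$-th column of $\boldsymbol F$, together with $\mathbf 0$. Let $\kappa_i=|\mathcal A_i|$, $\mu_j=|\mathcal B_j|$, and let $n_{i,1},\dots,n_{i,\kappa_i}$ and $m_{j,1},\dots,m_{j,\mu_j}$ be the monomials in $x_1,\dots,x_n$ with exponents in $\mathcal A_i$ and $\mathcal B_j$. With new indeterminates $\mathfrak d_{i,k},\mathfrak e_{j,k}$, define $$\mathfrak r_i=\sum_{k=1}^{\kappa_i}\mathfrak d_{i,k}n_{i,k}\ (1\le i\le s),\qquad \mathfrak m_j=\sum_{k=1}^{\mu_j}\mathfrak e_{j,k}m_{j,k}\ (1\le j\le q).$$ Let $\mathfrak c_{i,j}$ ($1\le i\le p$, $1\le j\le q$) be further indeterminates, $\mathfrak A$ the set of all indeterminates $\mathfrak d_{i,k},\mathfrak e_{j,k},\mathfrak c_{i,j}$, and $N=\sum_i\kappa_i+\sum_j\mu_j+pq$ its cardinality. Let $\mathfrak M=[\mathfrak c_{i,j}\mathfrak m_j]_{1\le i\le p,1\le j\le q}\in\mathbf K[\mathfrak A][x_1,\dots,x_n]^{p\times q}$ and $\mathfrak r=(\mathfrak r_1,\dots,\mathfrak r_s)$. With $t$ a new indeterminate, $\mathfrak B\subset\mathbf K[\mathfrak A][t,x_1,\dots,x_n]$ is the family consisting of the $s$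 polynomials $(1-t)\mathfrak r+t\boldsymbol g$ and all $p$-minors of $(1-t)\mathfrak M+t\boldsymbol F$. For $\rho\in\overline{\mathbf K}^N$, $\Theta_\rho$ denotes evaluation of the indeterminates $\mathfrak A$ at $\rho$, and $\boldsymbol B_{t=0}$ denotes $\boldsymbol B$ evaluated at $t=0$. An ideal is said to be of dimension zero here if its zero set in $\overline{\mathbf K}^n$ is finite (possibly empty). $\overline{\mathbf K}\langle\langle t\rangle\rangle$ is the field of Puiseux series in $t$ with coefficients in $\overline{\mathbf K}$; a vector $\boldsymbol\alpha\in\overline{\mathbf K}\langle\langle t\rangle\rangle^n$ is bounded if all its coordinates have non-negative valuation in $t$ (with $0$ having valuation $+\infty$). $V(\boldsymbol B)$ is the set of $\boldsymbol\alpha\in\overline{\mathbf K}\langle\langle t\rangle\rangle^n$ at which all polynomials of $\boldsymbol B$ (viewed as polynomials in $x_1,\dots,x_n$ with coefficients in $\overline{\mathbf K}[t]$) vanish. *)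

(* Defs.v *)
From HB Require Import structures.
From mathcomp Require Import all_boot all_order all_algebra.
From mathcomp Require Import boolp classical_sets functions cardinality fsbigop.
From mathcomp Require Import mpoly.
From mathcomp Require Import zify ring lra.

Set Implicit Arguments.
Unset Strict Implicit.
Unset Printing Implicit Defensive.

Import Order.TTheory GRing.Theory Num.Theory.

Local Open Scope classical_set_scope.
Local Open Scope ring_scope.

(* Puiseux series are coefficient functions [rat -> R] whose support is       *)
(* contained in {(N + k) / d : k in nat} for some integer N and some d > 0.   *)
Section PuiseuxSeries.
Variable R : comNzRingType.
Implicit Types (f g h : rat -> R) (d k : nat) (N M : int).

Definition puiseux_exp d N k : rat := (N + k%:Z)%:~R / d%:R.

Definition puiseux_supp d N f : Prop :=
  forall r, f r != 0 -> exists k, r = puiseux_exp d N k.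

Definition is_puiseux f : Prop := exists d N, (0 < d)%N /\ puiseux_supp d N f.

Definition puiseux_mul f g : rat -> R :=
  fun r => \sum_(a \in [set: rat]) f a * g (r - a).

Definition puiseux_monom_fun (c : R) (a : rat) : rat -> R :=
  fun r => if r == a then c else 0.

Let tr d N f k : {poly R} := \poly_(i < k) f (puiseux_exp d N i).

Lemma puiseux_exp_inj d N : (0 < d)%N -> injective (puiseux_exp d N).
Proof.
move=> d0 i j /divIf H; have {}/H : (d%:R : rat) != 0 by rewrite pnatr_eq0 -lt0n.
by move=> /intr_inj /addrI [].
Qed.

Lemma puiseux_exp_sub d N M i k : (i <= k)%N ->
  puiseux_exp d (N + M) k - puiseux_exp d N i = puiseux_exp d M (k - i).
Proof.
move=> ik; rewrite /puiseux_exp -mulrBl -rmorphB /=; congr (_%:~R / _).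
by rewrite -subzn //; ring.
Qed.

Lemma puiseux_expD d N M i j :
  puiseux_exp d N i + puiseux_exp d M j = puiseux_exp d (N + M) (i + j).
Proof.
by rewrite /puiseux_exp -mulrDl -rmorphD /=; congr (_%:~R / _); rewrite PoszD; ring.
Qed.

Lemma puiseux_mul_supp d N M f g :
  puiseux_supp d N f -> puiseux_supp d M g ->
  puiseux_supp d (N + M) (puiseux_mul f g).
Proof.
move=> Hf Hg r; apply: contraNP => /forallNP Hr; apply/eqP/fsbig1 => a _.
apply/eqP; apply: contraT => H.
have fa : f a != 0 by apply: contraNneq H => ->; rewrite mul0r.
have ga : g (r - a) != 0 by apply: contraNneq H => ->; rewrite mulr0.
have [i ai] := Hf _ fa; have [j aj] := Hg _ ga.
by case: (Hr (i + j)%N); rewrite -puiseux_expD -ai -aj [RHS]addrC subrK.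
Qed.

Lemma puiseux_mulE d N M f g K k : (0 < d)%N -> (k < K)%N ->
  puiseux_supp d N f -> puiseux_supp d M g ->
  puiseux_mul f g (puiseux_exp d (N + M) k) = (tr d N f K * tr d M g K)`_k.
Proof.
move=> d0 kK Hf Hg; rewrite coefM /puiseux_mul.
rewrite -(fsbig_widen (puiseux_exp d N @` `I_k.+1)) //; last first.
  move=> a [_ /= Ha]; apply/eqP; apply: contraT => H.
  have fa : f a != 0 by apply: contraNneq H => ->; rewrite mul0r.
  have ga : g (puiseux_exp d (N + M) k - a) != 0.
    by apply: contraNneq H => ->; rewrite mulr0.
  have [i ai] := Hf _ fa; have [j aj] := Hg _ ga.
  case: Ha; exists i => //=; rewrite -ltnS.
  have /(puiseux_exp_inj d0) -> : puiseux_exp d (N + M) k = puiseux_exp d (N + M) (i + j).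
    by rewrite -puiseux_expD -ai -aj [RHS]addrC subrK.
  lia.
rewrite fsbig_image; last by move=> i j _ _; exact: puiseux_exp_inj.
rewrite -(fsbig_ord _ _ (fun i => f (puiseux_exp d N i) *
   g (puiseux_exp d (N + M) k - puiseux_exp d N i))).
apply: eq_bigr => i _; rewrite puiseux_exp_sub -1?ltnS // !coef_poly.
have -> : (i < K)%N by have := ltn_ord i; lia.
by have -> : (k - i < K)%N by lia.
Qed.

Lemma puiseux_supp_mul d e N f : (0 < d)%N -> (0 < e)%N ->
  puiseux_supp d N f -> puiseux_supp (d * e) (N * e) f.
Proof.
move=> d0 e0 Hf r /Hf [k ->]; exists (k * e)%N.
rewrite /puiseux_exp natrM PoszM -mulrDl intrM -[(Posz e)%:~R]/(e%:R) -mulf_div.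
by rewrite divff ?mulr1 // pnatr_eq0 -lt0n.
Qed.

Lemma puiseux_supp_le d N M f : (0 < d)%N -> (M <= N) ->
  puiseux_supp d N f -> puiseux_supp d M f.
Proof.
move=> d0 MN Hf r /Hf [k ->]; exists (k + `|N - M|)%N.
by rewrite /puiseux_exp; congr (_%:~R / _); lia.
Qed.

Lemma puiseux_common2 f g : is_puiseux f -> is_puiseux g ->
  exists d N, [/\ (0 < d)%N, puiseux_supp d N f & puiseux_supp d N g].
Proof.
move=> [d [N [d0 Hf]]] [e [M [e0 Hg]]].
exists (d * e)%N, (Num.min (N * e) (M * d)); split; first by rewrite muln_gt0 d0.
  apply: (@puiseux_supp_le _ (N * e)); rewrite ?muln_gt0 ?d0 ?ge_min ?lexx //.
  exact: puiseux_supp_mul.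
apply: (@puiseux_supp_le _ (M * d)); rewrite ?muln_gt0 ?d0 ?ge_min ?lexx ?orbT //.
by rewrite mulnC; exact: puiseux_supp_mul.
Qed.

Lemma puiseux_common3 f g h : is_puiseux f -> is_puiseux g -> is_puiseux h ->
  exists d N, (0 < d)%N /\
   [/\ puiseux_supp d N f, puiseux_supp d N g & puiseux_supp d N h].
Proof.
move=> Hf Hg [e [M [e0 Hh]]].
have [d [N [d0 {}Hf {}Hg]]] := puiseux_common2 Hf Hg.
exists (d * e)%N, (Num.min (N * e) (M * d)); split; first by rewrite muln_gt0 d0.
split.
- apply: (@puiseux_supp_le _ (N * e)); rewrite ?muln_gt0 ?d0 ?ge_min ?lexx //.
  exact: puiseux_supp_mul.
- apply: (@puiseux_supp_le _ (N * e)); rewrite ?muln_gt0 ?d0 ?ge_min ?lexx //.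
  exact: puiseux_supp_mul.
apply: (@puiseux_supp_le _ (M * d)); rewrite ?muln_gt0 ?d0 ?ge_min ?lexx ?orbT //.
by rewrite mulnC; exact: puiseux_supp_mul.
Qed.

Lemma puiseux_eq d N f g : puiseux_supp d N f -> puiseux_supp d N g ->
  (forall k, f (puiseux_exp d N k) = g (puiseux_exp d N k)) -> f = g.
Proof.
move=> Hf Hg fg; apply/funext => r.
case: (eqVneq (f r) 0) => [fr0|/Hf [k ->]]; last exact: fg.
case: (eqVneq (g r) 0) => [->//|/Hg [k rk]]; by rewrite rk fg.
Qed.

Definition puiseux_pred : {pred rat -> R} := mem [set f | is_puiseux f].

Lemma puiseux_zmod_closed : zmod_closed puiseux_pred.
Proof.
split=> [|f g].
  by apply/mem_set; exists 1%N, 0; split => // r; rewrite eqxx.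
move=> /set_mem Hf /set_mem Hg; apply/mem_set.
have [d [N [d0 {}Hf {}Hg]]] := puiseux_common2 Hf Hg.
exists d, N; split => // r fg; case: (eqVneq (f r) 0) => [fr|]; last exact: Hf.
apply: Hg; apply: contraNneq fg => gr.
by rewrite -[(f - g) r]/(f r - g r) fr gr subr0.
Qed.

Lemma is_puiseux_mul f g :
  is_puiseux f -> is_puiseux g -> is_puiseux (puiseux_mul f g).
Proof.
move=> Hf Hg; have [d [N [d0 {}Hf {}Hg]]] := puiseux_common2 Hf Hg.
by exists d, (N + N); split => //; exact: puiseux_mul_supp.
Qed.

Lemma puiseux_monom_subproof c a : is_puiseux (puiseux_monom_fun c a).
Proof.
exists `|denq a|%N, (numq a); split; first by rewrite absz_gt0 denq_eq0.
move=> r; rewrite /puiseux_monom_fun; case: (eqVneq r a) => [->|]; last by rewrite eqxx.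
move=> _; exists 0%N; rewrite /puiseux_exp addr0 -[LHS]divq_num_den.
by rewrite -[(_)%:R]/((Posz `|denq a|)%:~R) absz_denq.
Qed.

Lemma puiseux_mulC f g : is_puiseux f -> is_puiseux g ->
  puiseux_mul f g = puiseux_mul g f.
Proof.
move=> Hf Hg; have [d [N [d0 {}Hf {}Hg]]] := puiseux_common2 Hf Hg.
apply: (@puiseux_eq d (N + N)); [exact: puiseux_mul_supp..|] => k.
by rewrite !(puiseux_mulE d0 (ltnSn k)) // mulrC.
Qed.

Lemma puiseux_mulDl f g h : is_puiseux f -> is_puiseux g -> is_puiseux h ->
  puiseux_mul (f + g) h = puiseux_mul f h + puiseux_mul g h.
Proof.
move=> Hf Hg Hh; have [d [N [d0 [{}Hf {}Hg {}Hh]]]] := puiseux_common3 Hf Hg Hh.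
have suppD N' u v : puiseux_supp d N' u -> puiseux_supp d N' v ->
    puiseux_supp d N' (u + v).
  move=> Hu Hv r uv; case: (eqVneq (u r) 0) => [ur|]; last exact: Hu.
  apply: Hv; apply: contraNneq uv => vr.
  by rewrite -[(u + v) r]/(u r + v r) ur vr addr0.
apply: (@puiseux_eq d (N + N)).
- by apply: puiseux_mul_supp => //; exact: suppD.
- by apply: suppD; exact: puiseux_mul_supp.
move=> k; rewrite -[RHS]/(_ (puiseux_exp d (N + N) k) + _ (puiseux_exp d (N + N) k)).
rewrite !(puiseux_mulE d0 (ltnSn k)) //; last exact: suppD.
rewrite -coefD -mulrDl; congr (polyseq (_ * _))`_k.
by apply/polyP => i; rewrite coefD !coef_poly; case: ifP; rewrite ?addr0.
Qed.

Lemma puiseux_mulA f g h : is_puiseux f -> is_puiseux g -> is_puiseux h ->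
  puiseux_mul f (puiseux_mul g h) = puiseux_mul (puiseux_mul f g) h.
Proof.
move=> Hf Hg Hh; have [d [N [d0 [{}Hf {}Hg {}Hh]]]] := puiseux_common3 Hf Hg Hh.
have Hfg := puiseux_mul_supp Hf Hg; have Hgh := puiseux_mul_supp Hg Hh.
apply: (@puiseux_eq d (N + (N + N))).
- exact: puiseux_mul_supp.
- by rewrite addrA; exact: puiseux_mul_supp.
move=> k; rewrite (puiseux_mulE d0 (ltnSn k)) // addrA (puiseux_mulE d0 (ltnSn k)) //.
set a := tr d N f k.+1; set b := tr d N g k.+1; set c := tr d N h k.+1.
have trM u v (Hu : puiseux_supp d N u) (Hv : puiseux_supp d N v) i : (i < k.+1)%N ->
    (tr d (N + N) (puiseux_mul u v) k.+1)`_i = (tr d N u k.+1 * tr d N v k.+1)`_i.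
  by move=> ik; rewrite coef_poly ik (puiseux_mulE d0 ik).
transitivity ((a * (b * c))`_k); last rewrite mulrA.
  by rewrite !coefM; apply: eq_bigr => i _; rewrite trM // ltnS leq_subr.
by rewrite !coefM; apply: eq_bigr => i _; rewrite trM.
Qed.

Lemma puiseux_mul_monom c a f r :
  puiseux_mul (puiseux_monom_fun c a) f r = c * f (r - a).
Proof.
rewrite /puiseux_mul -(fsbig_widen [set a]) ?fsbig_set1 //.
  by rewrite /puiseux_monom_fun eqxx.
by move=> b [_ /= /eqP/negPf ba]; rewrite /puiseux_monom_fun ba mul0r.
Qed.

End PuiseuxSeries.

Section PuiseuxRing.
Variable R : comNzRingType.

Record puiseux := Puiseux {
  puiseux_coef :> rat -> R;
  puiseux_coefP : puiseux_coef \in @puiseux_pred R }.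

HB.instance Definition _ := [isSub for puiseux_coef].
HB.instance Definition _ := [Choice of puiseux by <:].
HB.instance Definition _ :=
  GRing.isZmodClosed.Build (rat -> R) (@puiseux_pred R) (@puiseux_zmod_closed R).
HB.instance Definition _ := [SubChoice_isSubZmodule of puiseux by <:].

Implicit Types f g h : puiseux.

Lemma puiseuxP f g : (forall r, f r = g r) <-> f = g.
Proof. by split=> [fg|->//]; apply/val_inj/funext. Qed.

Let coef_is f : is_puiseux f := set_mem (puiseux_coefP f).

Definition puiseux_monom (c : R) (a : rat) : puiseux :=
  Puiseux (mem_set (puiseux_monom_subproof c a)).

Definition puiseux_one : puiseux := puiseux_monom 1 0.

Definition puiseux_times f g : puiseux :=
  Puiseux (mem_set (is_puiseux_mul (coef_is f) (coef_is g))).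

Lemma puiseux_timesA : associative puiseux_times.
Proof. by move=> f g h; apply/val_inj/puiseux_mulA. Qed.

Lemma puiseux_timesC : commutative puiseux_times.
Proof. by move=> f g; apply/val_inj/puiseux_mulC. Qed.

Lemma puiseux_times1 : left_id puiseux_one puiseux_times.
Proof.
by move=> f; apply/puiseuxP => r /=; rewrite puiseux_mul_monom mul1r subr0.
Qed.

Lemma puiseux_timesDl : left_distributive puiseux_times +%R.
Proof. by move=> f g h; apply/val_inj/puiseux_mulDl. Qed.

Lemma puiseux_one_neq0 : puiseux_one != 0.
Proof.
by apply/eqP => /puiseuxP/(_ 0)/eqP; rewrite /= /puiseux_monom_fun eqxx oner_eq0.
Qed.

HB.instance Definition _ := GRing.Zmodule_isComNzRing.Build puiseux
  puiseux_timesA puiseux_timesC puiseux_times1 puiseux_timesDl puiseux_one_neq0.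

Definition puiseux_const (c : R) : puiseux := puiseux_monom c 0.
Definition puiseux_t : puiseux := puiseux_monom 1 1.

Lemma puiseux_const_is_zmod_morphism : zmod_morphism puiseux_const.
Proof.
move=> c e; apply/puiseuxP => r; rewrite -[RHS]/(puiseux_const c r - puiseux_const e r).
by rewrite /= /puiseux_monom_fun; case: ifP; rewrite ?subr0.
Qed.

Lemma puiseux_const_is_monoid_morphism : monoid_morphism puiseux_const.
Proof.
split=> // c e; apply/puiseuxP => r; rewrite [RHS]puiseux_mul_monom subr0 /=.
by rewrite /puiseux_monom_fun; case: ifP; rewrite ?mulr0.
Qed.

HB.instance Definition _ := GRing.isZmodMorphism.Build R puiseux puiseux_const
  puiseux_const_is_zmod_morphism.
HB.instance Definition _ := GRing.isMonoidMorphism.Build R puiseux puiseux_const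
  puiseux_const_is_monoid_morphism.

Definition puiseux_of_poly : {poly R} -> puiseux :=
  horner_morph (fun c => mulrC puiseux_t (puiseux_const c)).

HB.instance Definition _ := GRing.RMorphism.on puiseux_of_poly.

(* [None] stands for +oo. *)
Definition puiseux_val f : option rat :=
  if f == 0 then None
  else Some (xget 0 [set a | f a != 0 /\ forall b, b < a -> f b = 0]).

Definition puiseux_nonneg_val f : Prop :=
  if puiseux_val f is Some v then 0 <= v else True.

Lemma puiseux_nonneg_valP f :
  puiseux_nonneg_val f <-> (forall b, b < 0 -> f b = 0).
Proof.
rewrite /puiseux_nonneg_val /puiseux_val; case: eqVneq => [-> //|f0].
have [d [N [d0 Hf]]] := coef_is f.
have [a fa] : exists a, f a != 0.
  apply: contrapT => /forallNP H; move/eqP: f0; apply; apply/puiseuxP => r.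
  by apply/eqP; apply: contraT => /H.
have exk : exists k, f (puiseux_exp d N k) != 0.
  by have [k ak] := Hf _ fa; exists k; rewrite -ak.
case: xgetP => [v _ [fv ltv]|/(_ (puiseux_exp d N (ex_minn exk)))].
  split=> [v0 b b0|H]; first exact/ltv/(lt_le_trans b0).
  by rewrite leNgt; apply/negP => /H /eqP; apply/negP.
case: ex_minnP => k fk mink []; split=> // b bk; apply/eqP; apply: contraT => fb.
have [j bj] := Hf _ fb; rewrite bj in fb bk; have := mink _ fb.
move: bk; rewrite /puiseux_exp ltr_pM2r ?invr_gt0 ?ltr0n // ltr_int => + kj.
by rewrite ltrD2l ltz_nat ltnNge kj.
Qed.

End PuiseuxRing.

Section Family.
Variables (K : fieldType) (n p q s : nat).
Variables (g : 'I_s -> {mpoly K[n]}) (F : 'M[{mpoly K[n]}]_(p, q)).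

Definition suppA (i : 'I_s) : seq 'X_{1..n} := undup (0%MM :: msupp (g i)).

Definition suppB (j : 'I_q) : seq 'X_{1..n} :=
  undup (0%MM :: flatten [seq msupp (F i j) | i <- enum 'I_p]).

(* The three summands index d_(i,k), e_(j,k) and c_(i,j); an indeterminate a is
   the variable of K[A] of index [enum_rank a]. *)
Definition indet : finType :=
  ({i : 'I_s & 'I_(size (suppA i))} + {j : 'I_q & 'I_(size (suppB j))}
   + 'I_p * 'I_q)%type.

Definition nb_indet : nat := #|indet|.

Lemma nb_indetE : nb_indet =
  (\sum_i size (suppA i) + \sum_j size (suppB j) + p * q)%N.
Proof.
rewrite /nb_indet !card_sum card_prod !card_tagged !sumnE !big_map -!enumT !big_enum !card_ord.
by congr (_ + _ + _)%N; apply: eq_big => // i _; rewrite card_ord.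
Qed.

Let KA : comNzRingType := {mpoly K[nb_indet]}.
(* Polynomials in x_1, ..., x_n whose coefficients are polynomials in t. *)
Let KAtx : comNzRingType := {mpoly {poly KA}[n]}.

Definition ind_d (i : 'I_s) (k : 'I_(size (suppA i))) : KA :=
  'X_(enum_rank (inl (inl (Tagged (fun i => 'I_(size (suppA i))) k)) : indet)).

Definition ind_e (j : 'I_q) (k : 'I_(size (suppB j))) : KA :=
  'X_(enum_rank (inl (inr (Tagged (fun j => 'I_(size (suppB j))) k)) : indet)).

Definition ind_c (i : 'I_p) (j : 'I_q) : KA :=
  'X_(enum_rank (inr (i, j) : indet)).

Definition frak_r (i : 'I_s) : KAtx :=
  \sum_(k < size (suppA i)) (ind_d k)%:P *: 'X_[nth 0%MM (suppA i) k].

Definition frak_m (j : 'I_q) : KAtx :=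
  \sum_(k < size (suppB j)) (ind_e k)%:P *: 'X_[nth 0%MM (suppB j) k].

Definition frak_M : 'M[KAtx]_(p, q) :=
  \matrix_(i, j) ((ind_c i j)%:P *: frak_m j).

Definition lift_base : {mpoly K[n]} -> KAtx :=
  map_mpoly (fun c : K => (c%:MP : KA)%:P).

Definition t_var : KAtx := ('X : {poly KA})%:MP.

(* A p-minor is given by the choice of p columns, in increasing order. *)
Definition column_choice : finType :=
  {f : {ffun 'I_p -> 'I_q} | [forall i : 'I_p, forall j : 'I_p, (i < j)%N ==> (f i < f j)%N]}.

Definition family_idx : finType := ('I_s + column_choice)%type.

Definition frak_B (k : family_idx) : KAtx :=
  match k with
  | inl i => (1 - t_var) * frak_r i + t_var * lift_base (g i)
  | inr f => \det (colsub (val f)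
               ((1 - t_var) *: frak_M + t_var *: map_mx lift_base F))
  end.

End Family.

Definition Theta (K L : fieldType) (iota : {rmorphism K -> L}) (N n : nat)
    (rho : 'I_N -> L) :
    {mpoly {poly {mpoly K[N]}}[n]} -> {mpoly {poly L}[n]} :=
  map_mpoly (map_poly (mmap iota rho)).

Definition eval_t0 (L : fieldType) (n : nat) :
    {mpoly {poly L}[n]} -> {mpoly L[n]} :=
  map_mpoly (horner_eval 0).

Definition generated_ideal (R : comNzRingType) (I : finType) (B : I -> R) : set R :=
  [set f | exists c : I -> R, f = \sum_k c k * B k].

Definition radical_ideal (R : comNzRingType) (J : set R) : Prop :=
  forall f m, J (f ^+ m) -> J f.

Definition zero_locus (L : fieldType) (n : nat) (J : set {mpoly L[n]}) :
    set ('I_n -> L) :=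
  [set x | forall f, J f -> f.@[x] = 0].

(* The zero set may be empty. *)
Definition dimension_zero (L : fieldType) (n : nat) (J : set {mpoly L[n]}) : Prop :=
  finite_set (zero_locus J).

Definition zariski_open (L : fieldType) (N : nat) (U : set ('I_N -> L)) : Prop :=
  exists J : set {mpoly L[N]}, U = ~` zero_locus J.

Definition puiseux_zeros (L : fieldType) (n : nat) (I : Type)
    (B : I -> {mpoly {poly L}[n]}) : set ('I_n -> puiseux L) :=
  [set alpha | forall k, mmap (@puiseux_of_poly L) alpha (B k) = 0].

Definition bounded (L : fieldType) (n : nat) (alpha : 'I_n -> puiseux L) : Prop :=
  forall i, puiseux_nonneg_val (alpha i).

(* Main.v *)
(* A system of n sparse equations whose coefficients are indeterminates can be
   solved for one coefficient per equation, so that its solution variety is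
   parametrized by the other coefficients and the unknowns.  Counting parameters
   and using that N polynomials in fewer than N variables are algebraically
   dependent, one gets three facts about generic coefficients: n + 1 equations
   with constant terms generate the unit ideal; for n such equations each unknown
   satisfies modulo the ideal a univariate polynomial, which is separable in
   characteristic zero; n equations that are quasi-homogeneous for nonzero weights
   have no zero in the torus.
   At t = 0 the p-minors are constant multiples of products of p column
   polynomials.  Generically they define an intersection of ideals given by n
   equations, pairwise comaximal by the first fact, and an ideal that contains a separable
   univariate polynomial in each variable is radical; this gives (i).  For (ii), the
   leading coefficients of a solution with a coordinate of negative valuation
   satisfy n face equations, quasi-homogeneous for the valuations, which the third
   fact excludes. *)

Require Import Defs.
From HB Require Import structures.
From mathcomp Require Import all_boot all_order all_algebra.
From mathcomp Require Import boolp classical_sets functions cardinality fsbigop.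
From mathcomp Require Import mpoly.
From mathcomp Require Import perm separable.
From mathcomp Require Import zify ring.

Set Implicit Arguments.
Unset Strict Implicit.
Unset Printing Implicit Defensive.

Import Order.TTheory GRing.Theory Num.Theory.

Local Open Scope classical_set_scope.
Local Open Scope ring_scope.

(** * Algebraic dependence of polynomials *)

(** Isolates the last variable, for inductions on the number of variables and for reading a
    dependence as a univariate relation. *)
Lemma muni_mmap (n : nat) (R S : comNzRingType) (f : {rmorphism R -> S})
    (h : 'I_n.+1 -> S) (p : {mpoly R[n.+1]}) :
  mmap f h p =
  (map_poly (mmap f (fun i : 'I_n => h (widen_ord (leqnSn n) i))) (muni p)).[h ord_max].
Proof.
rewrite muniE rmorph_sum horner_sum; apply: eq_bigr => m _.
rewrite /= map_polyZ /= map_polyXn hornerZ hornerXn /= mmapZ mmapX -mulrA.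
congr (_ * _); rewrite /mmap1 big_ord_recr /=; congr (_ * _).
by apply: eq_bigr => i _; rewrite mnmE.
Qed.

Lemma muni_eq0 (n : nat) (R : comNzRingType) (p : {mpoly R[n.+1]}) :
  (muni p == 0) = (p == 0).
Proof.
apply/eqP/eqP => [p0|->]; last exact: muni0.
(* [p] is its own value at the variables, which [muni_mmap] computes from [muni p]. *)
have {1}-> : p = mmap (@mpolyC n.+1 R) (fun i => 'X_i) p.
  rewrite /mmap [LHS]mpolyE; apply: eq_bigr => m _.
  by rewrite mmap1_id mul_mpolyC.
by rewrite muni_mmap p0 rmorph0 horner0.
Qed.

(** Induction on the number of variables: where the leading coefficient in the last variable does
    not vanish, a nonzero univariate polynomial remains, and over an algebraically closed field it
    has a nonroot. *)
Lemma mpoly_nonroot (L : closedFieldType) (N : nat) (P : {mpoly L[N]}) :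
  P != 0 -> exists rho, P.@[rho] != 0.
Proof.
elim: N P => [|N IHN] P P0.
  exists (fun=> 0); rewrite (nvar0_mpolyC P) mevalC.
  by apply: contraNneq P0 => P0; rewrite (nvar0_mpolyC P) P0 mpolyC0.
have := P0; rewrite -muni_eq0 -lead_coef_eq0 => /IHN [rho c0].
have /closed_nonrootP [x xP] : map_poly (meval rho) (muni P) != 0.
  apply: contraNneq c0 => Pr0; have := congr1 (fun p : {poly L} => p`_(size (muni P)).-1) Pr0.
  by rewrite /= coef_map coef0 lead_coefE => ->.
exists (fun i => if unlift ord_max i is Some j then rho j else x).
rewrite /meval muni_mmap unlift_none; apply: contraNneq xP => Px0.
rewrite rootE -[0 in eqbRHS]Px0; apply/eqP; congr _.[_]; apply: eq_map_poly => c /=.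
rewrite /meval; apply: eq_bigr => m _; congr (_ * _); apply: mmap1_eq => i.
suff -> : widen_ord (leqnSn N) i = lift ord_max i by rewrite liftK.
by apply/val_inj; rewrite /= /bump leqNgt ltn_ord.
Qed.

(** [msize] is the degree plus one, and 0 for the zero polynomial, so a bound [d.+1] means degree at
    most [d]. *)
Lemma msizeM_leS (n : nat) (R : idomainType) (p q : {mpoly R[n]}) (a b : nat) :
  (msize p <= a.+1)%N -> (msize q <= b.+1)%N -> (msize (p * q) <= (a + b).+1)%N.
Proof.
have [->|p0] := eqVneq p 0; first by rewrite mul0r mmeasure0.
have [->|q0] := eqVneq q 0; first by rewrite mulr0 mmeasure0.
by rewrite msizeM //; lia.
Qed.

Lemma msize_prod_leS (n : nat) (R : idomainType) (I : Type) (r : seq I)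
    (F : I -> {mpoly R[n]}) (d : I -> nat) :
  (forall i, msize (F i) <= (d i).+1)%N ->
  (msize (\prod_(i <- r) F i) <= (\sum_(i <- r) d i).+1)%N.
Proof.
move=> Fd; elim: r => [|i r IHr]; first by rewrite !big_nil msizeC oner_eq0.
by rewrite !big_cons; apply: msizeM_leS.
Qed.

Lemma msize_exp_leS (n : nat) (R : idomainType) (p : {mpoly R[n]}) (d k : nat) :
  (msize p <= d.+1)%N -> (msize (p ^+ k) <= (d * k).+1)%N.
Proof.
move=> pd; elim: k => [|k IHk]; first by rewrite expr0 muln0 msizeC oner_eq0.
by rewrite exprS mulnS; apply: msizeM_leS.
Qed.

Lemma left_kernel_neq0 (L : fieldType) (m n : nat) (A : 'M[L]_(m, n)) :
  (n < m)%N -> exists2 c : 'rV[L]_m, c != 0 & c *m A = 0.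
Proof.
move=> nm; have /rowV0Pn [c /sub_kermxP cA c0] : kermx A != 0.
  by rewrite -mxrank_eq0 mxrank_ker; have := rank_leq_col A; lia.
by exists c.
Qed.

(* The products [\prod_a y_a ^+ e_a * v ^+ (D - e_a)], with all [e_a <= D], are
   more numerous than the monomials that occur in them once D is large. *)
Lemma algebraic_dependence (L : fieldType) (M N : nat)
    (y : 'I_N -> {mpoly L[M]}) (v : {mpoly L[M]}) : (M < N)%N ->
  exists2 P : {mpoly L[N]}, P != 0 &
    forall z, v.@[z] != 0 -> P.@[fun a => (y a).@[z] / v.@[z]] = 0.
Proof.
move=> MN; pose d := (\max_a msize (y a) + msize v)%N.
(* With this [D], (dND+1)^M <= D (D+1)^M < (D+1)^(M+1) <= (D+1)^N, so the products outnumber the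
   monomials with exponents at most dND. *)
pose D := ((d * N).+1 ^ M)%N.
pose Q (e : {ffun 'I_N -> 'I_D.+1}) := \prod_a (y a ^+ e a * v ^+ (D - e a)).
have Qd e : (msize (Q e) <= (d * N * D).+1)%N.
  have -> : (d * N * D = \sum_(a < N) d * D)%N by rewrite sum_nat_const card_ord; ring.
  apply: msize_prod_leS => a.
  have -> : (d * D = d * e a + d * (D - e a))%N.
    by rewrite -mulnDr subnKC // -ltnS.
  apply: msizeM_leS; apply: msize_exp_leS; last first.
    exact: leq_trans (leq_addl _ _) (leqnSn _).
  apply: leq_trans (leqnSn _); apply: leq_trans (leq_addr _ _).
  exact: (leq_bigmax (F := fun a => msize (y a))).
pose mons := {ffun 'I_M -> 'I_(d * N * D).+1}.
(* Each row lists the coefficients of one product; a left kernel vector is a linear relation between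
   the products. *)
pose A := \matrix_(i < #|{: {ffun 'I_N -> 'I_D.+1}}|, j < #|{: mons}|)
   (Q (enum_val i))@_[multinom (enum_val j : mons) k : nat | k < M].
have [|c c0 cA] := @left_kernel_neq0 _ _ _ A.
  rewrite !card_ffun !card_ord.
  apply: (@leq_ltn_trans ((d * N).+1 ^ M * D.+1 ^ M)%N).
    rewrite -expnMn; have [->//|M0] := posnP M.
    by rewrite leq_exp2r // mulSn mulnS addSn ltnS; lia.
  apply: (@leq_trans (D.+1 ^ M.+1)%N); last by rewrite leq_pexp2l.
  by rewrite expnS ltn_mul2r expn_gt0 /= ltnS.
have cQ : \sum_i c ord0 i *: Q (enum_val i) = 0.
  apply/mpolyP => m; rewrite mcoeff0 raddf_sum /=.
  have [/forallP mM|/forallPn [k mk]] := boolP [forall k, m k < (d * N * D).+1]%N.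
    have cAm := congr1 (fun B : 'rV_ _ => B ord0 (enum_rank [ffun k => Ordinal (mM k)])) cA.
    rewrite !mxE in cAm; rewrite -[RHS]cAm; apply: eq_bigr => i _.
    rewrite mcoeffZ !mxE enum_rankK.
    congr (_ * _@__); apply/mnmP => k; by rewrite mnmE ffunE.
  apply: big1 => i _; rewrite mcoeffZ memN_msupp_eq0 ?mulr0 //.
  apply: msize_mdeg_ge; apply: leq_trans (Qd _) _; apply: leq_trans (_ : m k <= _)%N.
    by rewrite ltnNge.
  by rewrite mdegE (bigD1 k) //= leq_addr.
pose mon (e : {ffun 'I_N -> 'I_D.+1}) := [multinom e a : nat | a < N].
have mon_inj : injective mon.
  move=> e e' /mnmP ee; apply/ffunP => a; apply/val_inj.
  by have := ee a; rewrite !mnmE.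
exists (\sum_i c ord0 i *: 'X_[mon (enum_val i)]).
  apply: contraNneq c0 => P0; apply/eqP/rowP => i; rewrite mxE.
  have := congr1 (mcoeff (mon (enum_val i))) P0.
  rewrite mcoeff0 raddf_sum (bigD1 i) //= mcoeffZ mcoeffX eqxx mulr1 big1 ?addr0 //.
  move=> j ji; rewrite mcoeffZ mcoeffX (inj_eq mon_inj) (inj_eq enum_val_inj).
  by rewrite (negPf ji) mulr0.
move=> z v0; have := congr1 (meval z) cQ; rewrite meval0 raddf_sum /= => cQz.
(* This power of [v] clears the denominators: each of its [N] factors [v ^+ D] turns (y_a / v)^e
   into y_a^e v^(D-e). *)
have /mulIf : v.@[z] ^+ (D * N) != 0 by rewrite expf_neq0.
apply; rewrite mul0r -{}cQz raddf_sum /= mulr_suml; apply: eq_bigr => i _.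
rewrite !mevalZ -mulrA; congr (_ * _); rewrite mevalX rmorph_prod /=.
have -> : v.@[z] ^+ (D * N) = \prod_(a < N) v.@[z] ^+ D.
  by rewrite prodr_const card_ord exprM.
rewrite -big_split; apply: eq_bigr => a _ /=; rewrite mnmE mevalM !rmorphXn /=.
have : ((enum_val i) a <= D)%N by rewrite -ltnS.
move: ((enum_val i) a : nat) => e eD.
by rewrite -[in LHS](subnKC eD) exprD mulrA -exprMn divfK.
Qed.

(** * Ideals with separable univariate elements *)

Definition is_ideal (R : comNzRingType) (J : set R) : Prop :=
  [/\ J 0, forall a b, J a -> J b -> J (a + b) & forall c a, J a -> J (c * a)].

Section Ideals.
Variables (R : comNzRingType) (J : set R).
Hypothesis idealJ : is_ideal J.

Lemma ideal0 : J 0. Proof. by case: idealJ. Qed.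

Lemma idealD a b : J a -> J b -> J (a + b).
Proof. by case: idealJ => _ + _; apply. Qed.

Lemma idealMl c a : J a -> J (c * a).
Proof. by case: idealJ => _ _; apply. Qed.

Lemma idealMr c a : J a -> J (a * c).
Proof. by rewrite mulrC; exact: idealMl. Qed.

Lemma idealN a : J a -> J (- a).
Proof. by rewrite -mulN1r; exact: idealMl. Qed.

Lemma idealB a b : J a -> J b -> J (a - b).
Proof. by move=> Ja Jb; apply: idealD => //; apply: idealN. Qed.

Lemma ideal_sum (I : Type) (r : seq I) (P : pred I) (F : I -> R) :
  (forall i, P i -> J (F i)) -> J (\sum_(i <- r | P i) F i).
Proof. by move=> JF; elim/big_ind: _ => //; [exact: ideal0 | exact: idealD]. Qed.

Lemma ideal_cong a b : J (a - b) -> J b -> J a.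
Proof. by move=> Jab Jb; rewrite -[a](subrK b); apply: idealD. Qed.

Lemma ideal_congM a a' b b' : J (a - a') -> J (b - b') -> J (a * b - a' * b').
Proof.
move=> Ja Jb; have -> : a * b - a' * b' = (a - a') * b + a' * (b - b') by ring.
by apply: idealD; [exact: idealMr | exact: idealMl].
Qed.

Lemma ideal_congX a a' m : J (a - a') -> J (a ^+ m - a' ^+ m).
Proof.
move=> Ja; elim: m => [|m IHm]; first by rewrite !expr0 subrr; exact: ideal0.
by rewrite !exprS; exact: ideal_congM.
Qed.

Lemma ideal_mmap (n : nat) (K : nzRingType) (f : {rmorphism K -> R})
    (h h' : 'I_n -> R) (p : {mpoly K[n]}) :
  (forall i, J (h i - h' i)) -> J (mmap f h p - mmap f h' p).
Proof.
move=> Jh; rewrite /mmap -sumrB; apply: ideal_sum => m _.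
rewrite -mulrBr; apply: idealMl; rewrite /mmap1.
elim/big_ind2: _; first by rewrite subrr; exact: ideal0.
  by move=> a a' b b'; exact: ideal_congM.
by move=> i _; exact: ideal_congX.
Qed.

Lemma is_ideal_colon h : is_ideal [set a | J (h * a)].
Proof.
split=> [|a b Ja Jb|c a Ja] /=; first by rewrite mulr0; exact: ideal0.
  by rewrite mulrDr; exact: idealD.
by rewrite mulrCA; exact: idealMl.
Qed.

End Ideals.

Lemma is_ideal_generated (R : comNzRingType) (I : finType) (B : I -> R) :
  is_ideal (generated_ideal B).
Proof.
split=> [|_ _ [c ->] [d ->]|e _ [c ->]].
- by exists (fun=> 0); rewrite big1 // => i _; rewrite mul0r.
- exists (fun i => c i + d i); rewrite -big_split; apply: eq_bigr => i _ /=.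
  by rewrite mulrDl.
- by exists (fun i => e * c i); rewrite mulr_sumr; apply: eq_bigr => i _; rewrite mulrA.
Qed.

Lemma generated_ideal_mem (R : comNzRingType) (I : finType) (B : I -> R) k :
  generated_ideal B (B k).
Proof.
exists (fun i => (i == k)%:R); rewrite (bigD1 k) //= eqxx mul1r big1 ?addr0 // => i ik.
by rewrite (negPf ik) mul0r.
Qed.

(** A polynomial in [u] is congruent to its value at [a] modulo [u - a]. *)
Lemma prod_sub_const (L : fieldType) (n : nat) (u : {mpoly L[n]}) (a : L) (rs : seq L) :
  exists q, \prod_(b <- rs) (u - b%:MP) - (\prod_(b <- rs) (a - b))%:MP = q * (u - a%:MP).
Proof.
elim: rs => [|b rs [q IHrs]]; first by exists 0; rewrite !big_nil mul0r mpolyC1 subrr.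
exists (q * (u - b%:MP) + (\prod_(j <- rs) (a - j))%:MP); rewrite !big_cons mpolyCM mpolyCB.
by move: IHrs => /eqP; rewrite subr_eq => /eqP ->; ring.
Qed.

(* With [c := \prod_(b <- rs') (u - b)], the colon ideals [J : c] and
   [J : u - a] reduce the claim to [F * c \in J] and [F * (u - a) \in J], and
   [c] is a nonzero constant modulo [u - a]. *)
Lemma ideal_split (L : fieldType) (n : nat) (u : {mpoly L[n]}) (rs : seq L)
    (F : {mpoly L[n]}) (J : set {mpoly L[n]}) :
  uniq rs -> is_ideal J -> J (\prod_(a <- rs) (u - a%:MP)) ->
  (forall J' a, is_ideal J' -> J `<=` J' -> J' (u - a%:MP) -> J' F) -> J F.
Proof.
elim: rs J => [|a rs IHrs] J; first by rewrite big_nil => _ idJ /(idealMr idJ F); rewrite mul1r.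
rewrite big_cons /= => /andP[ars rs_uniq] idJ; set c := \prod_(b <- rs) _ => Jc JF.
have JcF : J (c * F).
  apply: (JF [set x | J (c * x)] a); first exact: is_ideal_colon.
    by move=> x Jx; exact: idealMl.
  by rewrite /= mulrC.
have JuF : J ((u - a%:MP) * F).
  apply: (IHrs [set x | J ((u - a%:MP) * x)]) => //; first exact: is_ideal_colon.
  move=> J' b idJ' JJ' J'b; apply: (JF J' b) => // x Jx; apply: JJ'; exact: idealMl.
pose k := \prod_(b <- rs) (a - b).
have k0 : k != 0.
  rewrite prodf_seq_neq0; apply/allP => b brs; rewrite subr_eq0.
  by apply: contraNneq ars => ->.
have [q ck] := prod_sub_const u a rs.
have -> : F = k^-1%:MP * (c * F - q * ((u - a%:MP) * F)).
  rewrite [q * _]mulrA -ck -mulrBl opprB addrC subrK mulrA -mpolyCM mulVf //.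
  by rewrite mpolyC1 mul1r.
by apply: idealMl => //; apply: idealB => //; exact: idealMl.
Qed.

(** [ideal_split] allows the ideal to be enlarged, one variable at a time, until every variable is
    constant modulo it. Then [F] is constant modulo the ideal as well. *)
Lemma radical_of_split (L : fieldType) (n : nat) (J : set {mpoly L[n]}) :
  is_ideal J ->
  (forall k, exists2 rs : seq L, uniq rs & J (\prod_(a <- rs) ('X_k - a%:MP))) ->
  radical_ideal J.
Proof.
move=> idJ split F m.
(* Induction on the number [l] of variables not yet known to be constant modulo the enlarged ideal
   [I]. *)
suff : forall l (I : set {mpoly L[n]}), is_ideal I -> J `<=` I ->
    (forall k : 'I_n, (l <= k)%N -> exists a, I ('X_k - a%:MP)) -> I (F ^+ m) -> I F.
  by move=> /(_ n J idJ); apply => // k; rewrite leqNgt ltn_ord.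
elim=> [|l IHl] I idI JI lin IFm.
  have /boolp.choice [a aP] : forall k, exists b, I ('X_k - b%:MP).
    by move=> k; exact: lin.
  have FE : I (F - F.@[a]%:MP).
    have := ideal_mmap idI (@mpolyC n L : {rmorphism L -> {mpoly L[n]}}) F aP.
    congr (I (_ - _)).
      by rewrite [RHS]mpolyE; apply: eq_bigr => M _; rewrite mmap1_id mul_mpolyC.
    rewrite mevalE rmorph_sum; apply: eq_bigr => M _; rewrite rmorphM rmorph_prod.
    by congr (_ * _); apply: eq_bigr => i _; rewrite rmorphXn.
  (* Either the constant is zero, or its power is a unit that lies in [I]. *)
  have [F0|F0] := eqVneq F.@[a] 0; first by move: FE; rewrite F0 mpolyC0 subr0.
  have : I ((F.@[a] ^+ m)%:MP).
    apply: (ideal_cong idI _ IFm).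
    by rewrite rmorphXn -opprB; apply: idealN => //; exact: ideal_congX.
  move/(idealMl idI (F * (F.@[a] ^+ m)^-1%:MP)).
  by rewrite -mulrA -mpolyCM mulVf ?expf_neq0 // mpolyC1 mulr1.
have [ln|nl] := ltnP l n; last first.
  by apply: (IHl I) => // k lk; apply: lin; have := ltn_ord k; lia.
have [rs rs_uniq Jrs] := split (Ordinal ln).
apply: (ideal_split rs_uniq idI (JI _ Jrs)) => I' a idI' II' I'a.
apply: (IHl I' idI') => [x /JI/II' //| k|]; last exact: II'.
rewrite leq_eqVlt => /predU1P[lk|/lin [b Ib]]; last by exists b; apply: II'.
by exists a; have <- : Ordinal ln = k by apply/val_inj.
Qed.

Lemma size_deriv_nat (A : idomainType) (p : {poly A}) :
  (forall k, k.+1%:R != 0 :> A) -> (1 < size p)%N -> p^`() != 0.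
Proof.
move=> char0 p1; apply/eqP => /(congr1 (fun q : {poly A} => q`_(size p).-2)).
rewrite coef_deriv coef0 => /eqP; rewrite -mulr_natr mulf_eq0 (negPf (char0 _)) orbF.
have -> : (size p).-2.+1 = (size p).-1 by lia.
by rewrite -/(lead_coef p) lead_coef_eq0 => /eqP p0; rewrite p0 size_poly0 in p1.
Qed.

(* A relation of minimal degree: as the kernel of evaluation is prime, no
   proper factor lies in it, whence it is coprime to its derivative. *)
Lemma separable_relation (A B : idomainType) (phi : {rmorphism A -> B}) (x : B)
    (p : {poly A}) :
  (forall k, k.+1%:R != 0 :> A) -> p != 0 -> (map_poly phi p).[x] = 0 ->
  exists f u v r, [/\ (map_poly phi f).[x] = 0, r != 0 & u * f + v * f^`() = r%:P].
Proof.
move=> char0 p0 px.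
pose rel k := `[< exists f, [/\ f != 0, (map_poly phi f).[x] = 0 & size f = k] >].
have ex_rel : exists k, rel k by exists (size p); apply/asboolP; exists p.
case: (ex_minnP ex_rel) => k /asboolP [f [f0 fx fk]] mink.
have small q : q != 0 -> (map_poly phi q).[x] = 0 -> (size f <= size q)%N.
  by move=> q0 qx; rewrite fk; apply: mink; apply/asboolP; exists q.
have cop : coprimep f f^`().
  rewrite /coprimep; set d := gcdp f f^`().
  have d0 : d != 0 by rewrite gcdp_eq0 (negPf f0).
  suff : (size d <= 1)%N by rewrite leq_eqVlt ltnS leqn0 size_poly_eq0 (negPf d0) orbF.
  rewrite leqNgt; apply/negP => d1.
  have df : (size d < size f)%N.
    have f1 : (1 < size f)%N by apply: leq_trans d1 _; apply: leq_gcdpl.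
    by apply: leq_ltn_trans (lt_size_deriv f0); apply: leq_gcdpr; exact: size_deriv_nat.
  (* Over a domain the gcd divides [f] only up to a nonzero scalar [c]. *)
  have /Pdiv.Idomain.dvdpP [[c q] /= c0 cf] := dvdp_gcdl f f^`(); rewrite -/d in cf.
  have q0 : q != 0.
    apply: contraNneq c0 => q0; move: cf; rewrite q0 mul0r => /eqP.
    by rewrite -mul_polyC mulf_eq0 polyC_eq0 (negPf f0) orbF.
  have := congr1 (fun g => (map_poly phi g).[x]) cf.
  rewrite /= map_polyZ hornerZ fx mulr0 rmorphM hornerM => /esym/eqP.
  rewrite mulf_eq0 => /orP[/eqP qx|/eqP dx].
    have := small q q0 qx; have := size_mul q0 d0.
    by rewrite -cf size_scale //; lia.
  by have := small d d0 dx; lia.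
have /Bezout_coprimepP [[u v] /=] := cop.
rewrite -size_poly_eq1 => /size_poly1P [r r0 uv].
by exists f, u, v, r.
Qed.

(** * Generic sparse systems *)

(** A single polynomial witnesses the open set, so that finite conjunctions amount to products. *)
Definition generic (L : fieldType) (N : nat) (Q : ('I_N -> L) -> Prop) : Prop :=
  exists2 P : {mpoly L[N]}, P != 0 & forall rho, P.@[rho] != 0 -> Q rho.

Section Generic.
Variables (L : fieldType) (N : nat).
Implicit Types Q : ('I_N -> L) -> Prop.

Lemma generic_mono Q Q' : (forall rho, Q rho -> Q' rho) -> generic Q -> generic Q'.
Proof. by move=> QQ' [P P0 PQ]; exists P => // rho /PQ/QQ'. Qed.

Lemma generic_all Q : (forall rho, Q rho) -> generic Q.
Proof. by exists 1; [exact: oner_neq0|]. Qed.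

Lemma generic_and Q Q' :
  generic Q -> generic Q' -> generic (fun rho => Q rho /\ Q' rho).
Proof.
move=> [P P0 PQ] [P' P'0 PQ']; exists (P * P'); first by rewrite mulf_neq0.
by move=> rho; rewrite mevalM mulf_eq0 negb_or => /andP[/PQ ? /PQ'].
Qed.

Lemma generic_forall (I : finType) (Q : I -> ('I_N -> L) -> Prop) :
  (forall i, generic (Q i)) -> generic (fun rho => forall i, Q i rho).
Proof.
move=> genQ.
have /boolp.choice [P PP] :
    forall i, exists P : {mpoly L[N]}, P != 0 /\ forall rho, P.@[rho] != 0 -> Q i rho.
  by move=> i; have [P P0 PQ] := genQ i; exists P.
exists (\prod_i P i) => [|rho].
  by apply/prodf_neq0 => i _; have [] := PP i.
rewrite rmorph_prod => /prodf_neq0 Prho i; have [_] := PP i; apply; exact: Prho.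
Qed.

End Generic.

Lemma generic_zariski_open (L : closedFieldType) (N : nat) (Q : ('I_N -> L) -> Prop) :
  generic Q ->
  exists Omega, [/\ zariski_open Omega, Omega !=set0 & forall rho, Omega rho -> Q rho].
Proof.
move=> [P P0 PQ]; exists (~` zero_locus [set P]); split; first by exists [set P].
  have [rho Prho] := mpoly_nonroot P0.
  by exists rho => /(_ P erefl) Prho0; rewrite Prho0 eqxx in Prho.
move=> rho /= nP; apply: PQ; apply/eqP => Prho; apply: nP => _ ->; exact: Prho.
Qed.

Lemma rmorph_mmap1 (n : nat) (S T : comNzRingType) (phi : {rmorphism S -> T})
    (h : 'I_n -> S) m : phi (mmap1 h m) = mmap1 (phi \o h) m.
Proof. by rewrite rmorph_prod; apply: eq_bigr => i _; rewrite rmorphXn. Qed.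

Lemma rmorph_mmap (n : nat) (R : nzRingType) (S T : comNzRingType)
    (phi : {rmorphism S -> T}) (f : {rmorphism R -> S}) (h : 'I_n -> S) p :
  phi (mmap f h p) = mmap (phi \o f) (phi \o h) p.
Proof.
by rewrite rmorph_sum; apply: eq_bigr => m _; rewrite rmorphM rmorph_mmap1.
Qed.

Lemma mmap_mpolyC (R S : nzRingType) (n : nat) (f : {rmorphism R -> S}) (h : 'I_n -> R)
   (p : {mpoly R[n]}) : mmap f (f \o h) p = f p.@[h].
Proof.
rewrite mevalE rmorph_sum; apply: eq_bigr => m _; rewrite rmorphM rmorph_prod.
by congr (_ * _); apply: eq_bigr => i _; rewrite rmorphXn.
Qed.

(** The case of denominator 1: vanishing at all points becomes an identity of polynomials by
    [mpoly_nonroot]. *)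
Lemma mmap_mpolyC_eq0 (L : closedFieldType) (M N : nat) (y : 'I_N -> {mpoly L[M]}) :
  (M < N)%N -> exists2 P : {mpoly L[N]}, P != 0 & mmap (@mpolyC M L) y P = 0.
Proof.
move=> MN; have [P P0 Py] := algebraic_dependence y 1 MN; exists P => //.
apply/eqP; apply: contraT => /mpoly_nonroot [z]; rewrite (rmorph_mmap (meval z)) => /negP[].
apply/eqP; rewrite -[RHS](Py z) ?meval1 ?oner_eq0 //; apply: eq_bigr => m _ /=.
rewrite mevalC; congr (_ * _); apply: mmap1_eq => i /=.
by rewrite divr1.
Qed.

(* The coefficient [a] belongs to the equation [own a], where it multiplies the
   monomial [mon a].  Only the equations of [D] are considered, and only the
   unknowns of [Q], the others being set to [1].  The equation [e] is solved for
   its coefficient [b e] and thus expresses it through the other coefficients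
   and the unknowns, with denominator [mon (b e)]. *)
Section SparseSystem.
Variables (L : closedFieldType) (N n : nat) (O : finType).
Variables (own : 'I_N -> option O) (mon : 'I_N -> 'X_{1..n}).

Definition block_poly (rho : 'I_N -> L) (e : O) : {mpoly L[n]} :=
  \sum_(a | own a == Some e) rho a *: 'X_[mon a].

Variables (D : {set O}) (b : O -> 'I_N) (Q : pred 'I_n).
Hypothesis own_b : {in D, forall e, own (b e) = Some e}.

Definition pivots : {set 'I_N} := b @: D.

Definition par_idx : finType := ({a | a \notin pivots} + {k | Q k})%type.

Definition par_coef (a : 'I_N) : {mpoly L[#|par_idx|]} :=
  if insub a is Some u then 'X_(enum_rank (inl u : par_idx)) else 0.

Definition par_unk (k : 'I_n) : {mpoly L[#|par_idx|]} :=
  if insub k is Some u then 'X_(enum_rank (inr u : par_idx)) else 1.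

Definition par_den : {mpoly L[#|par_idx|]} := \prod_(e in D) mmap1 par_unk (mon (b e)).

(** Numerators over the common denominator [par_den]. For a pivot [b e] this is Cramer-like: minus
    the other terms of equation [e], times the pivot monomials of the other equations. The value 0
    of [par_coef] at pivots removes the pivot term from the sum. *)
Definition par_num (a : 'I_N) : {mpoly L[#|par_idx|]} :=
  par_coef a * par_den - \sum_(e in D | b e == a)
    (\sum_(a' | own a' == Some e) par_coef a' * mmap1 par_unk (mon a')) *
    \prod_(e' in D | e' != e) mmap1 par_unk (mon (b e')).

Lemma b_inj : {in D &, injective b}.
Proof. by move=> e e' De De' bee; apply: Some_inj; rewrite -!own_b // bee. Qed.

(** Each equation removes a parameter and each unknown adds one; the [N] numerators are dependent as
    soon as fewer than [N] parameters are left. *)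
Lemma card_par_idx : (#|par_idx| + #|D| = N + #|Q|)%N.
Proof.
rewrite card_sum !card_sig.
have -> : #|[pred a | a \notin pivots]| = #|~: pivots|.
  by apply: eq_card => a; rewrite !inE.
have := cardsC pivots; rewrite card_ord card_in_imset; last exact: b_inj.
have -> : #|[pred k | Q k]| = #|Q| by apply: eq_card.
by lia.
Qed.

Section Evaluation.
Variables (S : comNzRingType) (kappa : {rmorphism L -> S}).
Variables (c : 'I_N -> S) (zeta : 'I_n -> S).
Hypothesis zetaQ : forall k, ~~ Q k -> zeta k = 1.

(** The target ring is kept general: it is the field for zeros in the torus, and the polynomial ring
    for computations modulo an ideal. *)
Definition par_point (i : 'I_#|par_idx|) : S :=
  match enum_val i with inl u => c (val u) | inr u => zeta (val u) end.

Local Notation ev := (mmap kappa par_point).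

Lemma mmap_par_coef a : ev (par_coef a) = if a \in pivots then 0 else c a.
Proof.
rewrite /par_coef; case: insubP => [u au ua|]; last by rewrite negbK => ->; rewrite rmorph0.
by rewrite mmapX mmap1U /par_point enum_rankK ua (negPf au).
Qed.

Lemma mmap_par_unk k : ev (par_unk k) = zeta k.
Proof.
rewrite /par_unk; case: insubP => [u ku uk|/zetaQ ->]; last by rewrite rmorph1.
by rewrite mmapX mmap1U /par_point enum_rankK uk.
Qed.

Lemma mmap_par_monom m : ev (mmap1 par_unk m) = mmap1 zeta m.
Proof. by rewrite rmorph_mmap1; apply: mmap1_eq => k /=; exact: mmap_par_unk. Qed.

Lemma mmap_par_den : ev par_den = \prod_(e in D) mmap1 zeta (mon (b e)).
Proof. by rewrite rmorph_prod; apply: eq_bigr => e _; rewrite /= mmap_par_monom. Qed.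

(** No equation is assumed to hold: the correction is a combination of the values of the equations,
    so it disappears at a zero, or modulo an ideal that contains them. *)
Lemma mmap_par_num a :
  ev (par_num a) = c a * ev par_den - \sum_(e in D | b e == a)
    (\sum_(a' | own a' == Some e) c a' * mmap1 zeta (mon a')) *
    \prod_(e' in D | e' != e) mmap1 zeta (mon (b e')).
Proof.
rewrite rmorphB rmorphM /= mmap_par_coef rmorph_sum /=.
under eq_bigr => e eD do rewrite rmorphM rmorph_sum rmorph_prod /=.
(* An equation contains no pivot but its own, so evaluation after the removal of pivots loses
   exactly one term. *)
have blockE e : e \in D -> \sum_(a' | own a' == Some e) ev (par_coef a' * mmap1 par_unk (mon a'))
    = (\sum_(a' | own a' == Some e) c a' * mmap1 zeta (mon a')) - c (b e) * mmap1 zeta (mon (b e)).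
  move=> eD; rewrite (bigD1 (b e)) ?own_b //= [in RHS](bigD1 (b e)) ?own_b //=.
  rewrite addrAC subrr add0r rmorphM /= mmap_par_coef imset_f // mul0r add0r.
  apply: eq_bigr => a' /andP[/eqP a'e a'b]; rewrite rmorphM /= mmap_par_coef mmap_par_monom.
  case: ifP => // /imsetP [e' e'D a'E]; case/eqP: a'b.
  by rewrite a'E; congr b; apply: Some_inj; rewrite -a'e a'E own_b.
have [/imsetP [e eD ->]|aN] := boolP (a \in pivots); last first.
  rewrite !big1 // => e /andP[eD /eqP ea]; first by rewrite -ea imset_f in aN.
  by rewrite -ea imset_f in aN.
have be e' : (e' \in D) && (b e' == b e) = (e' == e).
  apply/andP/eqP => [[e'D /eqP]|->]; last by rewrite eqxx.
  exact: b_inj.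
rewrite !(eq_bigl _ _ be) !big_pred1_eq blockE // mul0r sub0r.
under eq_bigr => e' _ do rewrite mmap_par_monom.
rewrite mmap_par_den [\prod_(e' in D) _](bigD1 e) //=.
rewrite mulrBl opprB; congr (_ - _); ring.
Qed.

(** When the pivots are constant terms, the denominator is 1 and the numerators themselves recover
    the coefficients modulo the ideal. *)
Lemma ideal_par_num (J : set S) a : is_ideal J ->
  {in D, forall e, mon (b e) = 0%MM} ->
  {in D, forall e, J (\sum_(a' | own a' == Some e) c a' * mmap1 zeta (mon a'))} ->
  J (ev (par_num a) - c a).
Proof.
move=> idJ b0 JD; rewrite mmap_par_num mmap_par_den big1 => [|e eD]; last by rewrite b0 ?mmap11.
rewrite mulr1 addrAC subrr sub0r; apply: idealN => //; apply: ideal_sum => // e /andP[eD _].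
by apply: idealMr => //; exact: JD.
Qed.

End Evaluation.

Lemma meval_block_poly rho e xi :
  (block_poly rho e).@[xi] = \sum_(a | own a == Some e) rho a * mmap1 xi (mon a).
Proof. by rewrite rmorph_sum; apply: eq_bigr => a _; rewrite /= mevalZ mevalX. Qed.

(** At a zero in the torus the denominator is nonzero and the fractions [par_num / par_den] take the
    values [rho]. With fewer than [N] parameters these fractions satisfy a nontrivial relation, so
    [rho] does too. *)
Lemma generic_no_torus_zero : (#|Q| < #|D|)%N ->
  generic (fun rho => forall xi : 'I_n -> L, (forall k, xi k != 0) ->
    (forall k, ~~ Q k -> xi k = 1) ->
    ~ {in D, forall e, (block_poly rho e).@[xi] = 0}).
Proof.
move=> QD; have MN : (#|par_idx| < N)%N by have := card_par_idx; lia.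
have [P P0 Py] := algebraic_dependence par_num par_den MN; exists P => // rho Prho xi xi0 xiQ zero.
have den0 : par_den.@[par_point rho xi] != 0.
  rewrite /meval (mmap_par_den idfun) //; apply/prodf_neq0 => e _.
  by apply/prodf_neq0 => k _; rewrite expf_neq0.
move: Prho => /eqP; apply.
rewrite -[RHS](Py _ den0); apply: meval_eq => a /=.
rewrite [(par_num a).@[_]](mmap_par_num idfun) // big1 => [|e /andP[eD _]]; last first.
  by rewrite -meval_block_poly zero // mul0r.
by rewrite subr0 mulfK.
Qed.

End SparseSystem.

Lemma horner_map_sum (A B : nzRingType) (f : {additive A -> B}) (p : {poly A}) (x : B) :
  (map_poly f p).[x] = \sum_(i < size p) f p`_i * x ^+ i.
Proof.
rewrite (@horner_coef_wide _ (size p)); last exact: size_poly.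
by apply: eq_bigr => i _; rewrite coef_map.
Qed.

(** * Ideals containing generic sparse equations *)

Section GenericIdeal.
Variables (L : closedFieldType) (N n : nat) (O : finType).
Variables (own : 'I_N -> option O) (mon : 'I_N -> 'X_{1..n}).
Variables (D : {set O}) (b : O -> 'I_N).
Hypothesis own_b : {in D, forall e, own (b e) = Some e}.
Hypothesis mon_b : {in D, forall e, mon (b e) = 0%MM}.

Local Notation num := (@par_num L N n O own mon D b predT).
Local Notation unk := (@par_unk L N n O D b predT).
Local Notation block := (block_poly own mon).
Local Notation ev rho :=
  (mmap (@mpolyC n L)
    (@par_point N n O D b predT {mpoly L[n]} (fun a => (rho a)%:MP_[n]) (fun k => 'X_k))).

Lemma card_par_idxT : (#|par_idx D b (@predT 'I_n)| + #|D| = N + n)%N.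
Proof. by rewrite (card_par_idx _ own_b) -[n in RHS]card_ord. Qed.

Lemma ideal_block_num (J : set {mpoly L[n]}) rho a : is_ideal J ->
  {in D, forall e, J (block rho e)} -> J (ev rho (num a) - (rho a)%:MP).
Proof.
move=> idJ JD; apply: (ideal_par_num own_b) => // e eD; move: (JD e eD).
congr (J _); apply: eq_bigr => a' _; by rewrite mmap1_id mul_mpolyC.
Qed.

(** If [P] is a relation between the numerators, this puts the constant [P.@[rho]] into the
    ideal. *)
Lemma ideal_block_mmap (J : set {mpoly L[n]}) rho (P : {mpoly L[N]}) : is_ideal J ->
  {in D, forall e, J (block rho e)} ->
  J (ev rho (mmap (@mpolyC _ L) num P) - (P.@[rho])%:MP).
Proof.
move=> idJ JD; rewrite rmorph_mmap -mmap_mpolyC.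
have -> : mmap (ev rho \o @mpolyC #|par_idx D b (@predT 'I_n)| L) (ev rho \o num) P =
    mmap (@mpolyC n L) (ev rho \o num) P.
  by apply: eq_bigr => m _; rewrite /= mmapC.
by apply: (@ideal_mmap _ _ idJ _ _ (@mpolyC n L)) => a; exact: ideal_block_num.
Qed.

(** There are fewer than [N] parameters, so the numerators satisfy some relation [P]; the ideal then
    contains the constant [P.@[rho]], generically a unit. *)
Lemma generic_ideal1 : (n < #|D|)%N ->
  generic (fun rho : 'I_N -> L => forall J : set {mpoly L[n]}, is_ideal J ->
    {in D, forall e, J (block rho e)} -> J 1).
Proof.
move=> nD; have MN : (#|par_idx D b (@predT 'I_n)| < N)%N.
  by rewrite -(ltn_add2r #|D|) card_par_idxT ltn_add2l.
have [P P0 Pnum] := mmap_mpolyC_eq0 num MN; exists P => // rho Prho J idJ JD.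
have := ideal_block_mmap P idJ JD; rewrite Pnum rmorph0 sub0r => /(idealN idJ).
rewrite opprK => /(idealMl idJ (P.@[rho])^-1%:MP).
by rewrite -mpolyCM mulVf // mpolyC1.
Qed.

(** At most [N] parameters are left, so the [N] numerators and one unknown are dependent: the
    unknown is a root of a polynomial over the coefficients. The roots [rs] are chosen before the
    ideal, so one finite list serves for all ideals containing the equations. *)
Lemma generic_split : [pchar L] =i pred0 -> (n <= #|D|)%N ->
  generic (fun rho : 'I_N -> L => forall k : 'I_n, exists2 rs : seq L, uniq rs &
    forall J : set {mpoly L[n]}, is_ideal J -> {in D, forall e, J (block rho e)} ->
      J (\prod_(a <- rs) ('X_k - a%:MP))).
Proof.
move=> /pcharf0P char0 nD; apply: generic_forall.
move=> k; have MN : (#|par_idx D b (@predT 'I_n)| < N.+1)%N.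
  by rewrite ltnS -(leq_add2r #|D|) card_par_idxT leq_add2l.
(* The unknown takes the last place, where [muni] isolates it. *)
pose y i := if unlift ord_max i is Some a then num a else unk k.
have [P P0] := mmap_mpolyC_eq0 y MN; rewrite muni_mmap.
rewrite {2}/y unlift_none => Pnum.
pose phi : {rmorphism {mpoly L[N]} -> {mpoly L[#|par_idx D b (@predT 'I_n)|]}} :=
  mmap (@mpolyC _ L) num.
have := @separable_relation _ _ phi (unk k) (muni P).
case=> [j|||f [u [v [r [fnum r0 uvf]]]]].
- by rewrite -[_%:R]mpolyC_nat mpolyC_eq0 char0.
- by rewrite muni_eq0.
- rewrite (@eq_map_poly _ _ phi
      (mmap (@mpolyC _ L) (fun i : 'I_N => y (widen_ord (leqnSn N) i)))) // => q.
  apply: eq_bigr => m _; congr (_ * _); apply: mmap1_eq => i; rewrite /y.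
  suff -> : widen_ord (leqnSn N) i = lift ord_max i by rewrite liftK.
  by apply/val_inj; rewrite /= /bump leqNgt ltn_ord.
(* Where [r] does not vanish, the Bezout identity between [f] and its derivative survives
   specialization at [rho]. *)
exists r => // rho rrho.
pose frho := map_poly (meval rho) f.
have sep : separable_poly frho.
  rewrite unlock; apply/Bezout_coprimepP.
  exists (map_poly (meval rho) u, map_poly (meval rho) v) => /=.
  by rewrite /frho deriv_map -!rmorphM -rmorphD /= uvf map_polyC /= -size_poly_eq1 size_polyC rrho.
have [rs] := closed_field_poly_normal frho; set c := lead_coef frho => frs.
have c0 : c != 0 by rewrite lead_coef_eq0; exact: separable_poly_neq0.
exists rs; first by rewrite -separable_prod_XsubC -(eqp_separable (eqp_scale _ c0)) -frs.
(* The relation vanishes with numerators as coefficients, and these are congruent to their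
   specializations at [rho]. *)
move=> J idJ JD; have Jf : J (map_poly (@mpolyC n L) frho).['X_k].
  have := congr1 (ev rho) fnum; rewrite rmorph0 -horner_map /= mmap_par_unk // => fev.
  rewrite -[X in J X]subr0 -fev -map_poly_comp -map_poly_comp !horner_map_sum -sumrB.
  apply: ideal_sum => // i _; rewrite -mulrBl; apply: idealMr => //=.
  by rewrite -opprB; apply: idealN => //; exact: ideal_block_mmap.
have := idealMl idJ c^-1%:MP Jf; rewrite [in map_poly _ _]frs map_polyZ hornerZ /= mulrA.
rewrite -mpolyCM mulVf // mpolyC1 mul1r.
rewrite rmorph_prod horner_prod; congr (J _); apply: eq_bigr => a _.
by rewrite rmorphB /= map_polyX map_polyC hornerXsubC.
Qed.

End GenericIdeal.

(** * Ideals generated by products of columns *)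

Lemma finite_set_box (L : choiceType) (n : nat) (x0 : L) (rs : 'I_n -> seq L) :
  finite_set [set x : 'I_n -> L | forall k, x k \in rs k].
Proof.
pose M := (\max_k size (rs k))%N.
pose pt (e : {ffun 'I_n -> 'I_M.+1}) : 'I_n -> L := fun k => nth x0 (rs k) (e k).
apply: (@sub_finite_set _ _ (pt @` setT)); last exact/finite_image/finite_finset.
move=> x /= xrs; exists [ffun k => inord (index (x k) (rs k))] => //.
apply/funext => k; rewrite /pt ffunE inordK ?nth_index ?xrs //.
apply: leq_trans (_ : size (rs k) <= M.+1)%N; first by rewrite index_mem xrs.
apply: leq_trans (leqnSn _); exact: (leq_bigmax (F := fun k => size (rs k))).
Qed.

Lemma column_choice_inj (p q : nat) (f : column_choice p q) : injective (val f).
Proof.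
case: f => f /= /forallP f_mono i j fij; apply/val_inj/eqP.
have lt (i' j' : 'I_p) : (i' < j')%N -> (f i' < f j')%N.
  by have /forallP /(_ j') /implyP := f_mono i'; apply.
by case: ltngtP => // /lt; rewrite fij ltnn.
Qed.

(** The enumeration of a set of ordinals is increasing, as [column_choice] demands. *)
Lemma column_choiceP (p q : nat) (S : {set 'I_q}) : #|S| = p ->
  exists f : column_choice p q, (val f @: 'I_p) = S.
Proof.
move=> Sp.
pose f := [ffun i : 'I_p => enum_val (cast_ord (esym Sp) i)].
have sortedS : sorted ltn (map val (enum S)).
  have -> : enum S = filter (mem S) (enum 'I_q) by rewrite !enumT.
  apply: (subseq_sorted ltn_trans (map_subseq val (filter_subseq _ _))).
  by rewrite val_enum_ord iota_ltn_sorted.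
have f_mono : [forall i : 'I_p, forall j : 'I_p, (i < j)%N ==> (f i < f j)%N].
  apply/forallP => i; apply/forallP => j; apply/implyP => ij; rewrite !ffunE.
  have szS (k : 'I_p) : (k < size (enum S))%N by rewrite -cardE Sp.
  have valE k : enum_val (cast_ord (esym Sp) k) = nth 0%N (map val (enum S)) k :> nat.
    pose x0 := enum_val (cast_ord (esym Sp) k).
    by rewrite (enum_val_nth x0) (nth_map x0).
  by rewrite !valE (sorted_ltn_nth ltn_trans) // inE size_map.
exists (exist _ f f_mono) => /=; apply/setP => j; apply/imsetP/idP => [[i _ ->]|jS].
  by rewrite ffunE; exact: enum_valP.
exists (cast_ord Sp (enum_rank_in jS j)) => //.
by rewrite ffunE cast_ordK enum_rankK_in.
Qed.

Lemma prod_column_choice (R : comNzRingType) (p q : nat) (f : column_choice p q)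
    (m : 'I_q -> R) : \prod_i m (val f i) = \prod_(j in (val f @: 'I_p)) m j.
Proof. by rewrite big_imset //=; move=> i j _ _; exact: column_choice_inj. Qed.

Lemma exists_subset_card (T : finType) (A : {set T}) (k : nat) :
  (k <= #|A|)%N -> exists2 B : {set T}, B \subset A & #|B| = k.
Proof.
rewrite cardE => kA; exists [set x in take k (enum A)]%SET.
  apply/fintype.subsetP => x; rewrite inE => /mem_take; by rewrite mem_enum.
rewrite cardsE (card_uniqP _) ?size_takel // take_uniq //; exact: enum_uniq.
Qed.

(** If at most [q - p] entries vanished, [p] nonzero ones would remain, with a nonzero product. *)
Lemma card_zero_columns (L : fieldType) (p q : nat) (m : 'I_q -> L) : (p <= q)%N ->
  (forall f : column_choice p q, \prod_i m (val f i) = 0) ->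
  (q - p < #|[set j | m j == 0%R]%SET|)%N.
Proof.
move=> pq m0; rewrite ltnNge; apply/negP => small.
have [|S SC Sp] := @exists_subset_card _ (~: [set j | m j == 0%R]%SET) p.
  by have := cardsC [set j | m j == 0%R]%SET; rewrite card_ord; lia.
have [f fS] := column_choiceP Sp; have := m0 f; rewrite prod_column_choice fS.
apply/eqP/prodf_neq0 => j jS; have := fintype.subsetP SC j jS.
by rewrite !inE.
Qed.

Section DeterminantalIdeal.
Variables (L : fieldType) (n p q s : nat).
Variables (r : 'I_s -> {mpoly L[n]}) (m : 'I_q -> {mpoly L[n]}).
Hypotheses (pq : (p <= q)%N).

Definition contains_eqs (I : set {mpoly L[n]}) (T : {set 'I_q}) : Prop :=
  (forall i, I (r i)) /\ {in T, forall j, I (m j)}.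

Hypothesis comaximal : forall (T : {set 'I_q}) I, ((q - p).+1 < #|T|)%N ->
  is_ideal I -> contains_eqs I T -> I 1.
Hypothesis split : forall (T : {set 'I_q}) k, (q - p < #|T|)%N ->
  exists2 rs : seq L, uniq rs &
    forall I, is_ideal I -> contains_eqs I T -> I (\prod_(a <- rs) ('X_k - a%:MP)).

Local Notation prodm S := (\prod_(j in S) m j).

Lemma contains_eqs_colon (I : set {mpoly L[n]}) (S : {set 'I_q}) : is_ideal I ->
  (forall i, I (r i)) -> (forall S' : {set 'I_q}, #|S'| = #|S|.+1 -> I (prodm S')) ->
  contains_eqs [set x | I (prodm S * x)] (~: S).
Proof.
move=> idI Ir Im; split=> [i|j jS] /=; first exact: idealMl.
rewrite finset.inE in jS.
by rewrite mulrC; have := Im (j |: S); rewrite big_setU1 ?cardsU1 ?jS //=; apply.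
Qed.

(** Descent on [k]: for a set [S] of size [k], the colon ideal by the product over [S] contains all
    columns outside [S]. These are numerous enough to give 1, so the product over [S] already lies
    in [I]; the empty product is reached in the end. *)
Lemma comaximal_products (k : nat) (I : set {mpoly L[n]}) : is_ideal I ->
  (forall i, I (r i)) -> (k < p)%N ->
  (forall S : {set 'I_q}, #|S| = k -> I (prodm S)) -> I 1.
Proof.
move=> idI Ir; elim: k => [|k IHk] kp Im.
  by have := Im finset.set0 (cards0 _); rewrite finset.big_set0.
apply: IHk; [exact: ltnW | move=> S Sk].
have := @comaximal (~: S) [set x | I (prodm S * x)].
rewrite /= mulr1; apply; last 1 first.
- by apply: contains_eqs_colon => // S' S'k; apply: Im; rewrite S'k Sk.
- by rewrite cardsCs finset.setCK card_ord Sk; lia.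
- exact: is_ideal_colon.
Qed.

Variable J : set {mpoly L[n]}.
Hypotheses (idJ : is_ideal J) (Jr : forall i, J (r i)).
Hypothesis Jm : forall S : {set 'I_q}, #|S| = p -> J (prodm S).

(** For [S] of size [p - 1], the colon ideal by the product over [S] contains the [q - p + 1] other
    columns, hence is radical and contains [F]. So the colon ideal by [F] contains all products of
    [p - 1] columns, and therefore 1. *)
Lemma radical_determinantal : radical_ideal J.
Proof.
(* For [p = 0] the empty product 1 lies in [J]. *)
have [p0|p0] := posnP p.
  move=> F k _; have := Jm (S := finset.set0); rewrite cards0 p0 big_set0 => /(_ erefl).
  by move/(idealMr idJ F); rewrite mul1r.
move=> F k JFk; suff : J (F * 1) by rewrite mulr1.
apply: (@comaximal_products p.-1 [set x | J (F * x)]); rewrite ?prednK //.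
- exact: is_ideal_colon.
- by move=> i; exact: idealMl.
move=> S Sp /=; rewrite mulrC.
have idS : is_ideal [set x | J (prodm S * x)] by exact: is_ideal_colon.
apply: (@radical_of_split _ _ [set x | J (prodm S * x)] idS _ F k) => [l|]; last exact: idealMl.
have [|rs rs_uniq rsP] := @split (~: S) l.
  by rewrite cardsCs finset.setCK card_ord Sp; lia.
exists rs => //; apply: rsP => //; apply: contains_eqs_colon => // S' S'p.
by apply: Jm; rewrite S'p Sp prednK.
Qed.

(** At a zero more than [q - p] columns vanish, so each coordinate is a root attached to that set of
    columns; there are finitely many such sets. *)
Lemma dimension_zero_determinantal : dimension_zero J.
Proof.
have /boolp.choice [rs rsP] : forall Tk : {set 'I_q} * 'I_n, exists rs : seq L,
    (q - p < #|Tk.1|)%N -> forall I, is_ideal I -> contains_eqs I Tk.1 ->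
      I (\prod_(a <- rs) ('X_(Tk.2) - a%:MP)).
  move=> [T k] /=; case: ltnP => [/(split k) [rs _ rsP]|_]; first by exists rs.
  by exists [::].
apply: sub_finite_set (finite_set_box 0 (fun k => flatten [seq rs (T, k) | T : {set 'I_q}])).
move=> x /= Jx k; pose T := [set j | (m j).@[x] == 0%R]%SET.
have Tq : (q - p < #|T|)%N.
  apply: card_zero_columns => // f; rewrite (prod_column_choice f (fun j => (m j).@[x])).
  have fp : #|val f @: 'I_p| = p by rewrite card_imset ?card_ord //; exact: column_choice_inj.
  by rewrite -[RHS](Jx _ (Jm fp)) rmorph_prod.
apply/flattenP; exists (rs (T, k)); first by rewrite map_f // mem_enum.
have /eqP : (\prod_(a <- rs (T, k)) ('X_k - a%:MP)).@[x] = 0.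
  (* The ideal used here consists of the polynomials vanishing at [x]. *)
  apply: (rsP (T, k) Tq [set h | h.@[x] = 0]).
    split=> [|a b /= a0 b0|c a /= a0]; first by rewrite /= meval0.
      by rewrite mevalD a0 b0 addr0.
    by rewrite mevalM a0 mulr0.
  split=> [i|j] /=; first by apply: Jx; exact: Jr.
  by rewrite inE => /eqP.
rewrite rmorph_prod prodf_seq_eq0 => /hasP [a ars] /=.
by rewrite mevalB mevalXU mevalC subr_eq0 => /eqP ->.
Qed.

End DeterminantalIdeal.

(** * The start system *)

Section Specialization.
Variables (K L : fieldType) (iota : {rmorphism K -> L}) (N n : nat) (rho : 'I_N -> L).

Local Notation KA := {mpoly K[N]}.
Local Notation KAtx := {mpoly {poly {mpoly K[N]}}[n]}.
Local Notation lift := (map_mpoly (@polyC L)).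
Local Notation tvar := (('X : {poly L})%:MP : {mpoly {poly L}[n]}).
Local Notation Th := (@Theta K L iota N n rho).

HB.instance Definition _ :=
  GRing.RMorphism.copy Th (@map_mpoly n _ _ (map_poly (mmap iota rho))).

Lemma ThetaZX (a : 'I_N) (m : 'X_{1..n}) :
  Th ((('X_a : KA)%:P : {poly KA}) *: 'X_[m]) = lift (rho a *: 'X_[m]).
Proof.
rewrite /Theta map_mpolyZ map_mpolyX [RHS]map_mpolyZ map_mpolyX.
by rewrite /= map_polyC /= mmapX mmap1U.
Qed.

Lemma ThetaZ (a : 'I_N) (P : KAtx) : Th (('X_a : KA)%:P *: P) = (rho a)%:P *: Th P.
Proof. by rewrite /Theta map_mpolyZ /= map_polyC /= mmapX mmap1U. Qed.

Lemma Theta_base (f : {mpoly K[n]}) :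
  Th (map_mpoly (fun c : K => (c%:MP : KA)%:P) f) = lift (map_mpoly iota f).
Proof.
apply/mpolyP => m; rewrite [LHS]mcoeff_map_mpoly.
rewrite (mcoeff_map_mpoly (@polyC KA \o @mpolyC N K)) !mcoeff_map_mpoly.
by rewrite /= map_polyC /= mmapC.
Qed.

Lemma Theta_homotopy (A B : KAtx) :
  Th ((1 - ('X : {poly KA})%:MP) * A + ('X : {poly KA})%:MP * B) =
  (1 - tvar) * Th A + tvar * Th B.
Proof.
have ThT : Th ('X : {poly KA})%:MP = tvar by rewrite /Theta map_mpolyC /= map_polyX.
by rewrite rmorphD !rmorphM rmorphB rmorph1 /= ThT.
Qed.

Lemma Theta_det (p q : nat) (c : 'I_p -> 'I_q -> 'I_N) (m : 'I_q -> KAtx)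
    (F : 'M[{mpoly K[n]}]_(p, q)) (f : 'I_p -> 'I_q) :
  Th (\det (colsub f ((1 - ('X : {poly KA})%:MP) *: (\matrix_(i, j) (('X_(c i j) : KA)%:P *: m j))
    + ('X : {poly KA})%:MP *: map_mx (map_mpoly (fun c : K => (c%:MP : KA)%:P)) F))) =
  \det (\matrix_(i, k) ((1 - tvar) * ((rho (c i (f k)))%:P *: Th (m (f k)))
    + tvar * lift (map_mpoly iota (F i (f k))))).
Proof.
rewrite -det_map_mx; congr (\det _); apply/matrixP => i k.
by rewrite !mxE -ThetaZ -Theta_base; exact: Theta_homotopy.
Qed.

HB.instance Definition _ :=
  GRing.RMorphism.copy (@eval_t0 L n) (@map_mpoly n _ _ (horner_eval (0 : L))).

Lemma eval_t0_lift (f : {mpoly L[n]}) : eval_t0 (lift f) = f.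
Proof.
apply/mpolyP => m; rewrite [LHS]mcoeff_map_mpoly mcoeff_map_mpoly; exact: hornerC.
Qed.

Lemma eval_t0_homotopy (A B : {mpoly {poly L}[n]}) :
  eval_t0 ((1 - tvar) * A + tvar * B) = eval_t0 A.
Proof.
have e0 : eval_t0 tvar = 0 by rewrite /eval_t0 map_mpolyC /= /horner_eval hornerX mpolyC0.
by rewrite rmorphD !rmorphM rmorphB rmorph1 /= e0 subr0 mul1r mul0r addr0.
Qed.

End Specialization.

Lemma det_scale_columns (R : comNzRingType) (k : nat) (A : 'M[R]_k) (d : 'I_k -> R) :
  \det (\matrix_(i, j) (A i j * d j)) = \det A * \prod_j d j.
Proof.
have -> : \prod_j d j = \det (diag_mx (\row_j d j)).
  by rewrite det_diag; apply: eq_bigr => j _; rewrite mxE.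
by rewrite -det_mulmx mul_mx_diag; congr (\det _); apply/matrixP => i j; rewrite !mxE.
Qed.

(** * Coefficients of the family and its system at t = 0 *)

Section Family.
Variables (K : fieldType) (L : closedFieldType) (iota : {rmorphism K -> L}).
Variables (n p q s : nat).
Variables (g : 'I_s -> {mpoly K[n]}) (F : 'M[{mpoly K[n]}]_(p, q)).

Local Notation N := (nb_indet g F).
Local Notation owner := ('I_s + 'I_q)%type.

(** The indeterminates c_(i,j) scale whole columns and are not coefficients of any sparse equation,
    hence [None]. *)
Definition coef_own (a : 'I_N) : option owner :=
  match enum_val a with
  | inl (inl u) => Some (inl (tag u))
  | inl (inr u) => Some (inr (tag u))
  | inr _ => None
  end.

Definition coef_mon (a : 'I_N) : 'X_{1..n} :=
  match enum_val a with
  | inl (inl u) => nth 0%MM (suppA g (tag u)) (tagged u)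
  | inl (inr u) => nth 0%MM (suppB F (tag u)) (tagged u)
  | inr _ => 0%MM
  end.

Definition coef_c (rho : 'I_N -> L) (i : 'I_p) (j : 'I_q) : L :=
  rho (enum_rank (inr (i, j) : indet g F)).

Local Notation block := (block_poly coef_own coef_mon).

Definition idx_d i (k : 'I_(size (suppA g i))) : 'I_N :=
  enum_rank (inl (inl (Tagged (fun i => 'I_(size (suppA g i))) k)) : indet g F).

Definition idx_e j (k : 'I_(size (suppB F j))) : 'I_N :=
  enum_rank (inl (inr (Tagged (fun j => 'I_(size (suppB F j))) k)) : indet g F).

Lemma block_sum_d (V : nmodType) (i : 'I_s) (G : 'I_N -> V) :
  \sum_(a | coef_own a == Some (inl i)) G a = \sum_k G (@idx_d i k).
Proof.
rewrite (reindex (@enum_rank (indet g F))) /=; last first.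
  by exists enum_val => a _; [exact: enum_rankK | exact: enum_valK].
under eq_bigl do rewrite /coef_own enum_rankK.
rewrite big_sumType big_sumType /= [X in _ + X]big1 ?addr0; last by case.
rewrite [X in _ + X]big1 ?addr0 //.
transitivity (\sum_(i' | i' == i) \sum_k G (@idx_d i' k)); last by rewrite big_pred1_eq.
by rewrite sig_big_dep; apply: eq_big => [u|[i' k] _] //=; rewrite andbT.
Qed.

Lemma block_sum_e (V : nmodType) (j : 'I_q) (G : 'I_N -> V) :
  \sum_(a | coef_own a == Some (inr j)) G a = \sum_k G (@idx_e j k).
Proof.
rewrite (reindex (@enum_rank (indet g F))) /=; last first.
  by exists enum_val => a _; [exact: enum_rankK | exact: enum_valK].
under eq_bigl do rewrite /coef_own enum_rankK.
rewrite big_sumType big_sumType /= [X in _ + X]big1 ?addr0; last by case.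
rewrite big1 ?add0r //.
transitivity (\sum_(j' | j' == j) \sum_k G (@idx_e j' k)); last by rewrite big_pred1_eq.
by rewrite sig_big_dep; apply: eq_big => [u|[j' k] _] //=; rewrite andbT.
Qed.

Local Notation lift := (map_mpoly (@polyC L)).
Local Notation tvar := (('X : {poly L})%:MP : {mpoly {poly L}[n]}).

Lemma Theta_frak_r rho i : Theta iota rho (frak_r g F i) = lift (block rho (inl i)).
Proof.
rewrite /block_poly block_sum_d (rmorph_sum lift) -[LHS]/(@Theta K L iota N n rho _).
rewrite /frak_r rmorph_sum; apply: eq_bigr => k _.
by rewrite /coef_mon /idx_d enum_rankK; exact: ThetaZX.
Qed.

Lemma Theta_frak_m rho j : Theta iota rho (frak_m g F j) = lift (block rho (inr j)).
Proof.
rewrite /block_poly block_sum_e (rmorph_sum lift) -[LHS]/(@Theta K L iota N n rho _).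
rewrite /frak_m rmorph_sum; apply: eq_bigr => k _.
by rewrite /coef_mon /idx_e enum_rankK; exact: ThetaZX.
Qed.

Lemma Theta_frak_B_inl rho i : Theta iota rho (frak_B g F (inl i)) =
  (1 - tvar) * lift (block rho (inl i)) + tvar * lift (map_mpoly iota (g i)).
Proof. by rewrite -Theta_frak_r -(@Theta_base K L iota N n rho); exact: Theta_homotopy. Qed.

Lemma Theta_frak_B_inr rho (f : column_choice p q) : Theta iota rho (frak_B g F (inr f)) =
  \det (\matrix_(i, k)
    ((1 - tvar) * ((coef_c rho i (val f k))%:P *: lift (block rho (inr (val f k))))
     + tvar * lift (map_mpoly iota (F i (val f k))))).
Proof.
under eq_mx => i k do rewrite -Theta_frak_m.
exact: (@Theta_det K L iota N n rho p q (fun i j => enum_rank (inr (i, j) : indet g F))).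
Qed.

Lemma eval_t0_frak_B_inl rho i :
  eval_t0 (Theta iota rho (frak_B g F (inl i))) = block rho (inl i).
Proof. by rewrite Theta_frak_B_inl eval_t0_homotopy eval_t0_lift. Qed.

Definition coef_det (rho : 'I_N -> L) (f : column_choice p q) : L :=
  \det (\matrix_(i, k) coef_c rho i (val f k)).

(** At t = 0 each column of the matrix is a column of constants times one polynomial, which comes
    out of the determinant. *)
Lemma eval_t0_frak_B_inr rho (f : column_choice p q) :
  eval_t0 (Theta iota rho (frak_B g F (inr f))) =
  coef_det rho f *: \prod_k block rho (inr (val f k)).
Proof.
rewrite Theta_frak_B_inr -det_map_mx -mul_mpolyC /coef_det -det_map_mx.
rewrite -det_scale_columns; congr (\det _); apply/matrixP => i k; rewrite !mxE.
rewrite -map_mpolyZ; apply: etrans (eval_t0_homotopy _ _) _.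
by rewrite mul_mpolyC; exact: eval_t0_lift.
Qed.

Lemma generic_coef_det (f : column_choice p q) : generic (fun rho => coef_det rho f != 0).
Proof.
pose P : {mpoly L[N]} :=
  \det (\matrix_(i, k) 'X_(enum_rank (inr (i, val f k) : indet g F))).
have PE rho : P.@[rho] = coef_det rho f.
  rewrite -det_map_mx; congr (\det _); apply/matrixP => i k.
  by rewrite !mxE /= mevalXU.
exists P => [|rho]; last by rewrite PE.
(* This specialization turns the chosen submatrix into the identity. *)
pose rho1 (a : 'I_N) : L :=
  if enum_val a is inr (i, j) then (j == val f i)%:R else 0.
suff : P.@[rho1] != 0 by apply: contraNneq => ->; rewrite meval0.
rewrite PE /coef_det (_ : \matrix_(i, k) _ = 1%:M) ?det1 ?oner_neq0 //.
apply/matrixP => i k; rewrite !mxE /coef_c /rho1 enum_rankK.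
by rewrite (inj_eq (@column_choice_inj _ _ f)) eq_sym.
Qed.

Definition active (T : {set 'I_q}) : {set owner} :=
  [set e : owner | match e with inl _ => true | inr j => j \in T end]%SET.

Lemma card_active T : #|active T| = (s + #|T|)%N.
Proof.
rewrite -sum1_card big_sumType /=.
under eq_bigl do rewrite inE; under [X in (_ + X)%N]eq_bigl do rewrite inE.
by rewrite !sum1_card card_ord.
Qed.

(** The origin was adjoined to every support, so each equation has a constant term, available as a
    pivot. *)
Lemma coef0_exists (e : owner) : exists a : 'I_N, coef_own a = Some e /\ coef_mon a = 0%MM.
Proof.
case: e => [i|j].
  have lt : (index 0%MM (suppA g i) < size (suppA g i))%N.
    by rewrite index_mem mem_undup inE eqxx.
  exists (idx_d (Ordinal lt)); rewrite /coef_own /coef_mon enum_rankK /=.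
  by rewrite nth_index // -index_mem.
have lt : (index 0%MM (suppB F j) < size (suppB F j))%N.
  by rewrite index_mem mem_undup inE eqxx.
exists (idx_e (Ordinal lt)); rewrite /coef_own /coef_mon enum_rankK /=.
by rewrite nth_index // -index_mem.
Qed.

(** The equations in [active T] number [s + #|T|], and n = q - p + s + 1: more than [q - p] columns
    give at least n equations, which split each unknown, and one column more makes the ideal
    trivial. *)
Lemma generic_start : [pchar K] =i pred0 -> (p <= q)%N -> n = (q - p + s + 1)%N ->
  generic (fun rho : 'I_N -> L =>
    let J := generated_ideal (fun k => eval_t0 (Theta iota rho (frak_B g F k))) in
    radical_ideal J /\ dimension_zero J).
Proof.
move=> charK pq nE.
have charL : [pchar L] =i pred0 by move=> k; rewrite (fmorph_pchar iota) charK.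
have /boolp.choice [b bP] := coef0_exists.
have own_b (D : {set owner}) : {in D, forall e, coef_own (b e) = Some e}.
  by move=> e _; case: (bP e).
have mon_b (D : {set owner}) : {in D, forall e, coef_mon (b e) = 0%MM}.
  by move=> e _; case: (bP e).
have comax : generic (fun rho : 'I_N -> L => forall T : {set 'I_q}, ((q - p).+1 < #|T|)%N ->
    forall J : set {mpoly L[n]}, is_ideal J -> {in active T, forall e, J (block rho e)} -> J 1).
  apply: generic_forall => T; case: ltnP => [qT|_]; last exact: generic_all.
  have nT : (n < #|active T|)%N by rewrite card_active; lia.
  by apply: (generic_mono _ (generic_ideal1 L (own_b _) (mon_b _) nT)) => rho H _.
have split : generic (fun rho : 'I_N -> L => forall T : {set 'I_q}, (q - p < #|T|)%N ->
    forall k : 'I_n, exists2 rs : seq L, uniq rs &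
      forall J : set {mpoly L[n]}, is_ideal J -> {in active T, forall e, J (block rho e)} ->
        J (\prod_(a <- rs) ('X_k - a%:MP))).
  apply: generic_forall => T; case: ltnP => [qT|_]; last exact: generic_all.
  have nT : (n <= #|active T|)%N by rewrite card_active; lia.
  by apply: (generic_mono _ (generic_split (own_b _) (mon_b _) charL nT)) => rho H _.
have dets := generic_forall generic_coef_det.
apply: (generic_mono _ (generic_and dets (generic_and comax split))).
move=> rho [det0 [Hcomax Hsplit]] J.
have idJ : is_ideal J by exact: is_ideal_generated.
pose r i : {mpoly L[n]} := block rho (inl i); pose m j : {mpoly L[n]} := block rho (inr j).
have eqs (I : set {mpoly L[n]}) T :
    contains_eqs r m I T -> {in active T, forall e, I (block rho e)}.
  by move=> [Ir Im] [i|j] => [_|]; [exact: Ir | rewrite inE; exact: Im].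
have Jr i : J (r i).
  rewrite /r -eval_t0_frak_B_inl.
  exact: (generated_ideal_mem (fun k => eval_t0 (Theta iota rho (frak_B g F k))) (inl i)).
have Jm (S : {set 'I_q}) : #|S| = p -> J (\prod_(j in S) m j).
  move=> Sp; have [f <-] := column_choiceP Sp.
  have Jf : J (coef_det rho f *: \prod_k m (val f k)).
    rewrite /m -eval_t0_frak_B_inr.
    exact: (generated_ideal_mem (fun k => eval_t0 (Theta iota rho (frak_B g F k))) (inr f)).
  (* The nonzero constant determinant is divided out of the minor. *)
  have := idealMl idJ (coef_det rho f)^-1%:MP Jf.
  by rewrite -mul_mpolyC mulrA -mpolyCM mulVf // mul1r prod_column_choice.
have comaximal (T : {set 'I_q}) I : ((q - p).+1 < #|T|)%N -> is_ideal I ->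
    contains_eqs r m I T -> I 1.
  by move=> qT idI /eqs; exact: Hcomax.
have splits (T : {set 'I_q}) k : (q - p < #|T|)%N -> exists2 rs : seq L, uniq rs &
    forall I, is_ideal I -> contains_eqs r m I T -> I (\prod_(a <- rs) ('X_k - a%:MP)).
  move=> qT; have [rs rs_uniq rsP] := Hsplit T qT k.
  by exists rs => // I idI /eqs; exact: rsP.
split; first exact: (radical_determinantal pq comaximal splits idJ Jr Jm).
exact: (dimension_zero_determinantal pq splits Jr Jm).
Qed.

End Family.

(** * Leading forms of Puiseux series *)

Section LeadingCoefficients.
Variable L : closedFieldType.
Implicit Types (f g : puiseux L) (v w : rat) (c d : L).

(** [c] may be zero: the valuation is at least [v], and [c] is the coefficient there. Sums with
    cancellation are thus allowed. *)
Definition has_lead f v c : Prop := (forall r, r < v -> f r = 0) /\ f v = c.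

Lemma has_lead0 v : has_lead 0 v 0.
Proof. by []. Qed.

Lemma has_lead_const c : has_lead (puiseux_const c) 0 c.
Proof.
by split=> [r r0|]; rewrite /= /puiseux_monom_fun ?eqxx // (lt_eqF r0).
Qed.

(** Recorded at exponent 0 rather than 1, so that a factor [t] annihilates leading coefficients
    without changing exponents. *)
Lemma has_lead_t : has_lead (puiseux_t L) 0 0.
Proof.
split=> [r r0|]; rewrite /= /puiseux_monom_fun //.
by rewrite (lt_eqF (lt_trans r0 ltr01)).
Qed.

Lemma has_lead_weaken f v w c : has_lead f w c -> v < w -> has_lead f v 0.
Proof.
move=> [fw _] vw; split=> [r rv|]; [exact/fw/(lt_trans rv) | exact: fw].
Qed.

Lemma has_leadD f g v c d : has_lead f v c -> has_lead g v d -> has_lead (f + g) v (c + d).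
Proof.
move=> [f0 <-] [g0 <-]; split=> // r rv.
by rewrite -[LHS]/(f r + g r) f0 // g0 // addr0.
Qed.

Lemma has_leadM f g v w c d : has_lead f v c -> has_lead g w d ->
  has_lead (f * g) (v + w) (c * d).
Proof.
move=> [f0 fv] [g0 gw]; split=> [r rvw|].
  rewrite -[LHS]/(puiseux_mul f g r); apply: fsbig1 => a _.
  have [av|va] := ltP a v; first by rewrite f0 // mul0r.
  by rewrite (g0 (r - a)) ?mulr0 // ltrBlDl; apply: lt_le_trans rvw _; rewrite lerD2r.
rewrite -[LHS]/(puiseux_mul f g (v + w)) /puiseux_mul.
(* Only the exponent [v] of [f] meets the exponent [w] of [g] without one factor vanishing. *)
rewrite -(fsbig_widen [set v]) //; first by rewrite fsbig_set1 fv addrAC subrr add0r gw.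
move=> a [_ /= /eqP av]; have [lt_av|] := ltP a v; first by rewrite f0 // mul0r.
rewrite le_eqVlt eq_sym (negPf av) /= => va.
by rewrite g0 ?mulr0 // ltrBlDl ltrD2r.
Qed.

Lemma has_leadX f v c k : has_lead f v c -> has_lead (f ^+ k) (v *+ k) (c ^+ k).
Proof.
move=> fv; elim: k => [|k IHk]; last by rewrite !exprS mulrS; exact: has_leadM.
by rewrite !expr0 mulr0n -(rmorph1 (@puiseux_const L)); exact: has_lead_const.
Qed.

Lemma has_lead_sum (I : Type) (r : seq I) (P : pred I) (F : I -> puiseux L) v (c : I -> L) :
  (forall i, P i -> has_lead (F i) v (c i)) ->
  has_lead (\sum_(i <- r | P i) F i) v (\sum_(i <- r | P i) c i).
Proof.
by move=> Fv; apply: (big_ind2 (fun f c => has_lead f v c)) => // *; exact: has_leadD.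
Qed.

Lemma has_lead_prod (I : Type) (r : seq I) (F : I -> puiseux L) (v : I -> rat) (c : I -> L) :
  (forall i, has_lead (F i) (v i) (c i)) ->
  has_lead (\prod_(i <- r) F i) (\sum_(i <- r) v i) (\prod_(i <- r) c i).
Proof.
move=> Fv; elim: r => [|i r IHr]; last by rewrite !big_cons; exact: has_leadM.
by rewrite !big_nil -(rmorph1 (@puiseux_const L)); exact: has_lead_const.
Qed.

(** The exponents depend on the column only, so every permutation contributes at the same total
    exponent. *)
Lemma has_lead_det k (A : 'M[puiseux L]_k) (v : 'I_k -> rat) (c : 'M[L]_k) :
  (forall i j, has_lead (A i j) (v j) (c i j)) -> has_lead (\det A) (\sum_j v j) (\det c).
Proof.
move=> Av; apply: has_lead_sum => sigma _; rewrite -[\sum_j v j]add0r.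
apply: has_leadM.
  by rewrite -(rmorph_sign (@puiseux_const L)); exact: has_lead_const.
rewrite [X in has_lead _ X _](reindex_inj (@perm_inj _ sigma)) /=.
by apply: has_lead_prod => i; exact: Av.
Qed.

(** The target [g] only needs valuation at least [v]: multiplied by [t], it does not reach the
    exponent [v]. *)
Lemma has_lead_homotopy f g v c d : has_lead f v c -> has_lead g v d ->
  has_lead ((1 - puiseux_t L) * f + puiseux_t L * g) v c.
Proof.
move=> fv gv; have -> : c = (1 - 0) * c + 0 * d by ring.
have lead1t : has_lead (1 - puiseux_t L) 0 (1 - 0).
  rewrite -[- puiseux_t L]mulN1r -[- 0]mulN1r -(rmorph1 (@puiseux_const L)) -rmorphN.
  apply: has_leadD; first exact: has_lead_const.
  by rewrite -[0]addr0; apply: has_leadM; [exact: has_lead_const | exact: has_lead_t].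
by apply: has_leadD; rewrite -[v]add0r; apply: has_leadM => //; exact: has_lead_t.
Qed.

Lemma has_lead_eq0 v c : has_lead 0 v c -> c = 0.
Proof. by move=> [_ <-]. Qed.

Lemma lead_exists f : f != 0 -> exists v c, c != 0 /\ has_lead f v c.
Proof.
move=> f0; have [d [N [d0 fdN]]] := set_mem (puiseux_coefP f).
have [a fa] : exists a, f a != 0.
  apply: contrapT => /forallNP fE; move/eqP: f0; apply; apply/puiseuxP => r.
  by apply/eqP; apply: contraT => /fE.
have exk : exists k, f (puiseux_exp d N k) != 0 by have [k ak] := fdN _ fa; exists k; rewrite -ak.
case: (ex_minnP exk) => k fk mink.
exists (puiseux_exp d N k), (f (puiseux_exp d N k)); split=> //; split=> // r rk.
apply/eqP; apply: contraT => fr; have [j rj] := fdN _ fr; rewrite rj in fr rk.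
have := mink _ fr; move: rk; rewrite /puiseux_exp ltr_pM2r ?invr_gt0 ?ltr0n // ltr_int.
by rewrite ltrD2l ltz_nat ltnNge => /negP.
Qed.

End LeadingCoefficients.

(** A face system is again a sparse system: the coefficients outside [W] are merely deprived of
    their equation. *)
Definition restrict_own (N : nat) (O : finType) (own : 'I_N -> option O) (W : {set 'I_N})
  (a : 'I_N) : option O := if a \in W then own a else None.

(** * Face equations of a Puiseux solution *)

Section LeadingForms.
Variables (L : closedFieldType) (N n : nat) (O : finType).
Variables (own : 'I_N -> option O) (mon : 'I_N -> 'X_{1..n}).
Variable b0 : O -> 'I_N.
Hypotheses (own_b0 : forall e, own (b0 e) = Some e) (mon_b0 : forall e, mon (b0 e) = 0%MM).
Variables (alpha : 'I_n -> puiseux L) (w : 'I_n -> rat) (xi : 'I_n -> L).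
Hypothesis lead_alpha : forall k, alpha k != 0 -> xi k != 0 /\ has_lead (alpha k) (w k) (xi k).

Local Notation block := (block_poly own mon).

(** These are the monomials that do not vanish at [alpha]. *)
Definition avoids (m : 'X_{1..n}) : bool := [forall k, (alpha k == 0) ==> (m k == 0)%N].

Definition weight (m : 'X_{1..n}) : rat := \sum_k w k *+ m k.

(** The default [b0 e] carries the monomial 1, which satisfies [avoids], so the minimum is over a
    nonempty set. *)
Definition lowest (e : O) : 'I_N :=
  [arg min_(a < b0 e | (own a == Some e) && avoids (mon a)) weight (mon a)]%O.

Definition lowest_weight (e : O) : rat := weight (mon (lowest e)).

Definition face : {set 'I_N} :=
  [set a | if own a is Some e then avoids (mon a) && (weight (mon a) == lowest_weight e)
           else false]%SET.

Local Notation block_face := (block_poly (restrict_own own face) mon).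

Lemma lowestP e : [/\ own (lowest e) = Some e, avoids (mon (lowest e)) &
  forall a, own a = Some e -> avoids (mon a) -> lowest_weight e <= weight (mon a)].
Proof.
rewrite /lowest_weight /lowest; case: arg_minP => [|a /andP[/eqP ae av] amin].
  rewrite own_b0 eqxx /= mon_b0; apply/forallP => k; apply/implyP => _; by rewrite mnm0E.
by split=> // a' a'e a'v; apply: amin; rewrite a'e eqxx.
Qed.

Lemma has_lead_monom m v : (avoids m -> v <= weight m) ->
  has_lead (mmap1 alpha m) v (if avoids m && (weight m == v) then mmap1 xi m else 0).
Proof.
have [mv /(_ isT)|/forallPn [k]] := boolP (avoids m); last first.
  rewrite negb_imply => /andP[/eqP ak mk] _ /=.
  by rewrite /mmap1 (bigD1 k) //= ak expr0n (negPf mk) mul0r; exact: has_lead0.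
have lead_m : has_lead (mmap1 alpha m) (weight m) (mmap1 xi m).
  apply: has_lead_prod => k; have [ak|/lead_alpha [_ ak]] := eqVneq (alpha k) 0.
    have /forallP /(_ k) := mv; rewrite ak eqxx => /eqP ->.
    by rewrite mulr0n !expr0 -(rmorph1 (@puiseux_const L)); exact: has_lead_const.
  exact: has_leadX.
rewrite le_eqVlt eq_sym => /predU1P[<-|vm]; first by rewrite eqxx.
by rewrite (gt_eqF vm); exact: has_lead_weaken lead_m vm.
Qed.

(** Terms of higher weight and terms vanishing at [alpha] contribute nothing at the lowest weight;
    the face polynomial at [xi] remains. *)
Lemma has_lead_block rho e :
  has_lead (mmap (@puiseux_const L) alpha (block rho e)) (lowest_weight e)
    (block_face rho e).@[xi].
Proof.
rewrite meval_block_poly rmorph_sum /=.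
under eq_bigr => a _ do rewrite mmapZ mmapX.
rewrite [X in has_lead _ _ X]big_mkcond [X in has_lead X _ _]big_mkcond /=.
apply: has_lead_sum => a _; rewrite /restrict_own inE.
case: eqP => [ae|ae]; last first.
  rewrite (_ : _ == Some e = false); first exact: has_lead0.
  by apply/eqP; case: ifP.
have [_ _ low] := lowestP e.
have := has_leadM (has_lead_const (rho a)) (has_lead_monom (low a ae)).
rewrite ae add0r; case: ifP => _; first by rewrite eqxx.
by rewrite mulr0.
Qed.

(** Bounds the valuation of the target polynomials, whose supports lie in those of the sparse
    equations; the value of [c] is immaterial to [has_lead_homotopy]. *)
Lemma has_lead_supported (f : {mpoly L[n]}) e :
  (forall m, m \in msupp f -> exists2 a, own a = Some e & mon a = m) ->
  exists c, has_lead (mmap (@puiseux_const L) alpha f) (lowest_weight e) c.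
Proof.
move=> fe; have [_ _ low] := lowestP e.
exists (\sum_(m <- msupp f) f@_m *
  (if avoids m && (weight m == lowest_weight e) then mmap1 xi m else 0)).
rewrite /mmap big_seq [X in has_lead _ _ X]big_seq; apply: has_lead_sum => m /fe [a ae <-].
by rewrite -[lowest_weight e]add0r; apply: has_leadM;
   [exact: has_lead_const | rewrite add0r; apply: has_lead_monom; exact: low].
Qed.

Lemma restrict_lowest e : restrict_own own face (lowest e) = Some e.
Proof.
by have [le lv _] := lowestP e; rewrite /restrict_own inE le lv eqxx.
Qed.

(* Faces are quasi-homogeneous for the weights [w], so that the zeros of the
   corresponding equations are stable under [xi k |-> lambda ^ (d * w k) * xi k];
   one coordinate of nonzero weight can thus be normalized to [1]. *)
Lemma normalized_zero k0 : alpha k0 != 0 -> w k0 < 0 ->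
  exists zeta : 'I_n -> L, [/\ forall k, zeta k != 0, zeta k0 = 1 &
    forall rho e, (block_face rho e).@[xi] = 0 -> (block_face rho e).@[zeta] = 0].
Proof.
(* A common denominator [d] makes the weights [d * w k] integers [z k]. *)
move=> ak0 wk0; pose d : int := \prod_k denq (w k).
have d0 : 0 < d by apply: prodr_gt0 => k _; exact: denq_gt0.
have /boolp.choice [z zP] : forall k, exists z : int, z%:~R = d%:~R * w k.
  move=> k; exists (numq (w k) * \prod_(l | l != k) denq (w l)).
  by rewrite /d [in RHS](bigD1 k) //= !intrM numqE; ring.
have zk0 : z k0 < 0 by rewrite -(ltr_int rat) zP pmulr_rlt0 ?ltr0z.
have [h zh] : exists h, z k0 = - (h.+1)%:Z by case: (z k0) zk0 => // h _; exists h.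
(* As [z k0] is minus [h.+1], this root makes [lambda ^ z k0] the inverse of [xi k0]. *)
have [lambda lambdaP] : exists lambda : L, lambda ^+ h.+1 = xi k0.
  have /closed_rootP [x] : size ('X^(h.+1) - (xi k0)%:P : {poly L}) != 1%N.
    by rewrite size_XnsubC.
  by rewrite rootE !hornerE subr_eq0 => /eqP; exists x.
have lambda0 : lambda != 0.
  have [xik0 _] := lead_alpha ak0; apply: contraNneq xik0 => l0.
  by rewrite -lambdaP l0 expr0n.
(* At the zero coordinates of [alpha] the value 1 keeps [zeta] in the torus; no face monomial
   contains these unknowns. *)
pose zeta k : L := if alpha k == 0 then 1 else xi k * lambda ^ z k.
exists zeta; split=> [k||rho e].
- rewrite /zeta; case: (eqVneq (alpha k) 0) => [_|ak]; first exact: oner_neq0.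
  by have [xik _] := lead_alpha ak; rewrite mulf_neq0 // expfz_neq0.
- by rewrite /zeta (negPf ak0) zh -exprnN lambdaP divff //; case: (lead_alpha ak0).
have scale m : avoids m ->
    mmap1 zeta m = lambda ^ (\sum_k z k *+ m k) * mmap1 xi m.
  move=> mv; rewrite (big_morph _ (fun a b => expfzDr a b lambda0) (expr0z _)) /mmap1 -big_split.
  apply: eq_bigr => k _ /=; rewrite /zeta; case: (eqVneq (alpha k) 0) => [ak|_].
    by have /forallP /(_ k) := mv; rewrite ak eqxx => /eqP ->; rewrite mulr0n expr0z !expr0 mulr1.
  by rewrite exprMn mulrC -[z k *+ m k]mulr_natr natz -exprz_exp.
have zE (m : 'X_{1..n}) : (\sum_k z k *+ m k)%:~R = d%:~R * weight m :> rat.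
  rewrite rmorph_sum mulr_sumr; apply: eq_bigr => k _.
  by rewrite rmorphMn /= zP mulrnAr.
rewrite !meval_block_poly => xi0.
(* All monomials of a face have the weight of the lowest one, so a common power of [lambda] factors
   out. *)
transitivity (lambda ^ (\sum_k z k *+ mon (lowest e) k) *
    \sum_(a | restrict_own own face a == Some e) rho a * mmap1 xi (mon a)).
  2: by rewrite xi0 mulr0.
rewrite mulr_sumr; apply: eq_bigr => a; rewrite /restrict_own inE => aface.
have /andP[av /eqP aw] : avoids (mon a) && (weight (mon a) == lowest_weight e).
  by move: aface; case ae: (own a) => [e'|//]; case: ifP => // ? /eqP [<-].
rewrite scale // mulrCA; congr (_ * _); congr (_ ^ _).
by apply: (@intr_inj rat); rewrite !zE aw.
Qed.

End LeadingForms.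

Section Puiseux.
Variables (L : closedFieldType) (n : nat) (alpha : 'I_n -> puiseux L).

Local Notation ev := (mmap (@puiseux_of_poly L) alpha).
Local Notation lift := (map_mpoly (@polyC L)).
Local Notation tvar := (('X : {poly L})%:MP : {mpoly {poly L}[n]}).

Lemma puiseux_lift (f : {mpoly L[n]}) : ev (lift f) = mmap (@puiseux_const L) alpha f.
Proof.
rewrite {1}[f]mpolyE (rmorph_sum lift) (rmorph_sum ev) [RHS]/mmap; apply: eq_bigr => m _.
rewrite /= map_mpolyZ map_mpolyX mmapZ mmapX; congr (_ * _); exact: horner_morphC.
Qed.

Lemma puiseux_homotopy (A B : {mpoly {poly L}[n]}) :
  ev ((1 - tvar) * A + tvar * B) = (1 - puiseux_t L) * ev A + puiseux_t L * ev B.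
Proof.
have evt : ev tvar = puiseux_t L by rewrite mmapC; exact: horner_morphX.
by rewrite rmorphD !rmorphM rmorphB rmorph1 /= evt.
Qed.

Lemma has_lead_ev_homotopy (A B : {mpoly {poly L}[n]}) v c d :
  has_lead (ev A) v c -> has_lead (ev B) v d ->
  has_lead (ev ((1 - tvar) * A + tvar * B)) v c.
Proof. by rewrite puiseux_homotopy; exact: has_lead_homotopy. Qed.

Lemma puiseux_scale_lift (c : L) (f : {mpoly L[n]}) :
  ev (c%:P *: lift f) = puiseux_const c * mmap (@puiseux_const L) alpha f.
Proof. by rewrite mmapZ puiseux_lift; congr (_ * _); exact: horner_morphC. Qed.

End Puiseux.

(** * Boundedness of the Puiseux zeros *)

Section Boundedness.
Variables (K : fieldType) (L : closedFieldType) (iota : {rmorphism K -> L}).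
Variables (n p q s : nat).
Variables (g : 'I_s -> {mpoly K[n]}) (F : 'M[{mpoly K[n]}]_(p, q)).

Local Notation N := (nb_indet g F).
Local Notation owner := ('I_s + 'I_q)%type.
Local Notation own := (@coef_own K n p q s g F).
Local Notation mon := (@coef_mon K n p q s g F).
Local Notation block := (block_poly own mon).

Lemma supp_g i m : m \in msupp (map_mpoly iota (g i)) ->
  exists2 a : 'I_N, own a = Some (inl i) & mon a = m.
Proof.
rewrite mcoeff_msupp mcoeff_map_mpoly fmorph_eq0 -mcoeff_msupp => mg.
have lt : (index m (suppA g i) < size (suppA g i))%N.
  by rewrite index_mem mem_undup inE mg orbT.
exists (idx_d F (Ordinal lt)); rewrite /coef_own /coef_mon enum_rankK //=.
by rewrite nth_index // -index_mem.
Qed.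

Lemma supp_F i j m : m \in msupp (map_mpoly iota (F i j)) ->
  exists2 a : 'I_N, own a = Some (inr j) & mon a = m.
Proof.
rewrite mcoeff_msupp mcoeff_map_mpoly fmorph_eq0 -mcoeff_msupp => mF.
have lt : (index m (suppB F j) < size (suppB F j))%N.
  rewrite index_mem mem_undup inE; apply/orP; right; apply/flattenP.
  by exists (msupp (F i j)) => //; apply/mapP; exists i => //; rewrite mem_enum.
exists (idx_e g (Ordinal lt)); rewrite /coef_own /coef_mon enum_rankK //=.
by rewrite nth_index // -index_mem.
Qed.

(** The face depends on the solution but is one of finitely many sets [W], so a finite conjunction
    covers all cases. With one unknown set to 1, n - 1 unknowns face at least n equations. *)
Lemma generic_face_empty : (p <= q)%N -> n = (q - p + s + 1)%N ->
  generic (fun rho : 'I_N -> L => forall (k0 : 'I_n) (W : {set 'I_N}) (T : {set 'I_q}),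
    (q - p < #|T|)%N ->
    (forall e, exists b, restrict_own own W b = Some e) ->
    forall xi : 'I_n -> L, (forall k, xi k != 0) -> xi k0 = 1 ->
    ~ {in active s T, forall e, (block_poly (restrict_own own W) mon rho e).@[xi] = 0}).
Proof.
move=> pq nE; apply: generic_forall => k0; apply: generic_forall => W.
apply: generic_forall => T; case: (ltnP (q - p) #|T|) => qT; last exact: generic_all.
have [/boolp.choice [b own_b]|nb] :=
    pselect (forall e, exists b, restrict_own own W b = Some e); last first.
  by apply: generic_all.
have cardQ : (#|[pred k | k != k0]| < #|active s T|)%N.
  by rewrite card_active; have := cardC1 k0; rewrite card_ord => ->; lia.
apply: (generic_mono _
  (generic_no_torus_zero L mon (fun e (_ : e \in active s T) => own_b e) cardQ)).
move=> rho H _ _ xi xi0 xik0; apply: H => // k; rewrite negbK => /eqP ->; exact: xik0.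
Qed.

(** A coordinate of negative valuation would yield, after normalization, a torus zero of the face
    equations of all [r_i] and of more than [q - p] columns. *)
Lemma generic_bounded : (p <= q)%N -> n = (q - p + s + 1)%N ->
  generic (fun rho : 'I_N -> L => forall alpha,
    puiseux_zeros (fun k => Theta iota rho (frak_B g F k)) alpha -> bounded alpha).
Proof.
move=> pq nE; have /boolp.choice [b0 b0P] := @coef0_exists K n p q s g F.
have own_b0 e : own (b0 e) = Some e by case: (b0P e).
have mon_b0 e : mon (b0 e) = 0%MM by case: (b0P e).
have dets := generic_forall (@generic_coef_det K L n p q s g F).
apply: (generic_mono _ (generic_and dets (generic_face_empty pq nE))) => rho [det0 empty].
move=> alpha zeros k0; apply/puiseux_nonneg_valP => b b_neg; apply/eqP; apply: contraT => ab.
have ak0 : alpha k0 != 0 by apply: contraNneq ab => ->.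
(* A zero coordinate gets the placeholder [(0, 0)]; [avoids] keeps its unknown out of the faces. *)
have /boolp.choice [lead leadP] : forall k, exists vc : rat * L,
    alpha k != 0 -> vc.2 != 0 /\ has_lead (alpha k) vc.1 vc.2.
  move=> k; case: (eqVneq (alpha k) 0) => [_|/lead_exists [v [c cP]]]; first by exists (0, 0).
  by exists (v, c).
pose w k := (lead k).1; pose xi k := (lead k).2.
have wk0 : w k0 < 0.
  apply: le_lt_trans b_neg; rewrite leNgt; apply: contraNN ab => bw.
  by have [_ [f0 _]] := leadP k0 ak0; rewrite f0.
have [zeta [zeta0 zetak0 zetaP]] := normalized_zero own mon b0 leadP ak0 wk0.
pose W := face own mon b0 alpha w.
pose mu j := (block_poly (restrict_own own W) mon rho (inr j)).@[xi].
pose T := [set j | mu j == 0%R]%SET.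
(* At the sum of the lowest weights of its columns, a minor has the coefficient [coef_det] times the
   product of the [mu]. The minor is zero and the determinant is not, so the product vanishes. *)
have qT : (q - p < #|T|)%N.
  apply: card_zero_columns => // f; have := zeros (inr f); rewrite Theta_frak_B_inr.
  have detE : \det (\matrix_(i, k) (coef_c rho i (val f k) * mu (val f k))) =
      coef_det rho f * \prod_k mu (val f k).
    by rewrite -det_scale_columns; congr (\det _); apply/matrixP => i k; rewrite !mxE.
  rewrite -det_map_mx => detB; apply/eqP; rewrite -[_ == 0](mulrI_eq0 _ (mulfI (det0 f))) -detE.
  apply/eqP; apply: (has_lead_eq0 (v := \sum_k lowest_weight own mon b0 alpha w (inr (val f k)))).
  rewrite -detB; apply: has_lead_det => i k; rewrite !mxE.
  have [c fc] := has_lead_supported own_b0 mon_b0 leadP (@supp_F i (val f k)).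
  apply: (has_lead_ev_homotopy (d := c)); last by rewrite puiseux_lift.
  rewrite puiseux_scale_lift -[lowest_weight _ _ _ _ _ _]add0r.
  by apply: has_leadM; [exact: has_lead_const | exact: has_lead_block].
suff : False by []; apply: (empty k0 W T qT _ zeta zeta0 zetak0) => [e|[i|j]].
- by exists (lowest own mon b0 alpha w e); exact: restrict_lowest.
- move=> _; apply: zetaP; have := zeros (inl i).
  rewrite Theta_frak_B_inl => ri0.
  apply: (has_lead_eq0 (v := lowest_weight own mon b0 alpha w (inl i))); rewrite -ri0.
  have [c gc] := has_lead_supported own_b0 mon_b0 leadP (@supp_g i).
  by apply: (has_lead_ev_homotopy (d := c)); rewrite puiseux_lift //; exact: has_lead_block.
- by rewrite inE inE => /eqP; exact: zetaP.
Qed.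

End Boundedness.

Theorem proposition4p1 (K : fieldType) (L : closedFieldType)
    (iota : {rmorphism K -> L}) (n p q s : nat)
    (g : 'I_s -> {mpoly K[n]}) (F : 'M[{mpoly K[n]}]_(p, q)) :
  [pchar K] =i pred0 ->
  (forall z : L, algebraicOver iota z) ->
  (p <= q)%N ->
  n = (q - p + s + 1)%N ->
  exists Omega : set ('I_(nb_indet g F) -> L),
    [/\ zariski_open Omega,
        Omega !=set0
      & forall rho, Omega rho ->
          let B := fun k => Theta iota rho (frak_B g F k) in
          let J := generated_ideal (fun k => eval_t0 (B k)) in
          [/\ radical_ideal J,
              dimension_zero J
            & forall alpha, puiseux_zeros B alpha -> bounded alpha]].
Proof.
move=> charK _ pq nE; apply: generic_zariski_open.
apply: (generic_mono _ (generic_and (generic_start iota g F charK pq nE)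
  (generic_bounded iota g F pq nE))) => rho [[radJ dimJ] bddB] B J.
by split.
Qed.
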